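(* Assume that $H$ and $(c_{ij})$ satisfy (A1)–(A4) listed in the context. Let $$\mathcal{M}:=\overline{\bigcup_{\mu\in\tilde{\mathcal M}}\operatorname{supp}\big(\operatorname{proj}_{\mathbb{T}^d\times I}\mu\big)}\subset\mathbb{T}^d\times I,$$ where $\tilde{\mathcal M}$ is the set of generalized Mather measures and $\operatorname{proj}_{\mathbb{T}^d\times I}\mu$ is the marginal of $\mu$ on $\mathbb{T}^d\times I$. Then $\mathcal{M}$ is a uniqueness set: if $v_1,v_2:\mathbb{T}^d\times I\to\mathbb{R}$ are Lipschitz continuous viscosity solutions of $$H(x,Dv(x,i),i)+\sum_{j=1}^m c_{ij}\,(v(x,i)-v(x,j))=0\quad\text{in }\mathbb{T}^d\times I$$ and $v_1=v_2$ on $\mathcal{M}$, then $v_1=v_2$ on $\mathbb{T}^d\times I$.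
   Context: $\mathbb{T}^d$ is the $d$-dimensional flat torus, $m\in\mathbb{N}$ is fixed and $I=\{1,\dots,m\}$. The $c_{ij}\ge 0$ ($i,j\in I$) are given constants, and $H:\mathbb{T}^d\times\mathbb{R}^d\times I\to\mathbb{R}$ is such that $H(\cdot,\cdot,i)\in C^2(\mathbb{T}^d\times\mathbb{R}^d)$ for all $i\in I$. Assumptions: (A1) for every $x\in\mathbb{T}^d$ and $i\in I$, $p\mapsto H(x,p,i)$ is convex; (A2) uniformly for $x\in\mathbb{T}^d$ and $i\in I$, $\lim_{|p|\to\infty}H(x,p,i)/|p|=\infty$ and $\lim_{|p|\to\infty}\left(\frac{1}{2d}H(x,p,i)^2+D_xH(x,p,i)\cdot p\right)=\infty$; (A3) there is $C>0$ with $|D_xH(x,p,i)|\le C(1+|p|^2)$ for all $(x,p,i)\in \mathbb{T}^d\times\mathbb{R}^d\times I$; (A4) $c_{ij}=c_{ji}$ for all $i,j\in I$. Viscosity solutions of the system: a function $v$ with each $v(\cdot,i)$ continuous is a viscosity subsolution (resp. supersolution) if for each $i\in I$ and each $\varphi\in C^1(\mathbb{T}^d)$ such that $v(\cdot,i)-\varphi$ has a maximum (resp. minimum) at $x$, one has $H(x,D\varphi(x),i)+\sum_j c_{ij}(v(x,i)-v(x,j))\le 0$ (resp. $\ge 0$); a solution is both. For $\phi:\mathbb{T}^d\times I\to\mathbb{R}$ set $\Theta\phi(x,i)=\sum_{j=1}^m c_{ij}(\phi(x,i)-\phi(x,j))$. Set $L(x,q,i)=\sup_{p\in\mathbb{R}^d}\{p\cdot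 q-H(x,p,i)\}$. Let $\mathcal{F}$ be the set of Radon probability measures $\mu$ on $\mathbb{T}^d\times\mathbb{R}^d\times I$ such that $$\int_{\mathbb{T}^d\times\mathbb{R}^d\times I} \big(q\cdot D\phi(x,i)+\Theta\phi(x,i)\big)\,d\mu(x,q,i)=0$$ (the integrand being integrable) for all $\phi$ with $\phi(\cdot,i)\in C^1(\mathbb{T}^d)$ for every $i\in I$. A generalized Mather measure is a minimizer of $\inf_{\mu\in\mathcal{F}}\int L(x,q,i)\,d\mu(x,q,i)$; $\tilde{\mathcal M}$ denotes the set of all generalized Mather measures. *)

(* Defs.v *)
From HB Require Import structures.
From mathcomp Require Import all_boot all_order all_algebra.
From mathcomp Require Import all_classical all_reals all_analysis.

Set Implicit Arguments.
Unset Strict Implicit.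
Unset Printing Implicit Defensive.

Import Order.TTheory GRing.Theory Num.Theory.
Import numFieldNormedType.Exports.

Local Open Scope classical_set_scope.
Local Open Scope ring_scope.
Local Open Scope quotient_scope.

(* The norm that the library puts on row vectors is the sup norm; the
   Euclidean structure is therefore defined here. *)
Definition dot (R : realType) (d : nat) (u v : 'rV[R]_d) : R :=
  \sum_(j < d) u 0 j * v 0 j.

Definition enorm (R : realType) (d : nat) (u : 'rV[R]_d) : R :=
  Num.sqrt (dot u u).

Definition grad (R : realType) (d : nat) (f : 'rV[R]_d -> R) (x : 'rV[R]_d) :
    'rV[R]_d :=
  \row_(j < d) 'D_(delta_mx 0 j) f x.

(* For finite-dimensional V, continuity of every directional derivative is
   continuity of all the partial derivatives. *)
Definition is_C1 (R : realType) (V : normedModType R) (f : V -> R) : Prop :=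
  (forall x, differentiable f x) /\ (forall v, continuous ('D_v f)).

Definition is_C2 (R : realType) (V : normedModType R) (f : V -> R) : Prop :=
  is_C1 f /\ (forall v, is_C1 ('D_v f)).

Section Torus.
Variables (R : realType) (d : nat).

Definition lattice_eq (x y : 'rV[R]_d) : bool :=
  [forall j, x 0 j - y 0 j \is a Num.int].

Lemma lattice_eq_refl : reflexive lattice_eq.
Proof. by move=> x; apply/forallP => j; rewrite subrr rpred0. Qed.

Lemma lattice_eq_sym : symmetric lattice_eq.
Proof.
by move=> x y; apply: eq_forallb => j; rewrite -opprB rpredN.
Qed.

Lemma lattice_eq_trans : transitive lattice_eq.
Proof.
move=> y x z /forallP xy /forallP yz; apply/forallP => j.
by rewrite -(subrKA (y 0 j)) rpredD.
Qed.

Canonical lattice_equiv :=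
  EquivRel lattice_eq lattice_eq_refl lattice_eq_sym lattice_eq_trans.

(* T^d = R^d / Z^d with the quotient topology. *)
Definition torus := quotient_topology {eq_quot lattice_equiv}.
HB.instance Definition _ := Topological.on torus.
HB.instance Definition _ := Pointed.on torus.
HB.instance Definition _ := Quotient.on torus.

Definition tproj (x : 'rV[R]_d) : torus := \pi_torus x.

Definition torus_C1 (f : torus -> R) : Prop := is_C1 (f \o tproj).

(* The gradient of the periodic lift does not depend on the representative. *)
Definition tgrad (f : torus -> R) (x : torus) : 'rV[R]_d :=
  grad (f \o tproj) (repr x).

Definition tdist (x y : torus) : R :=
  inf [set r | exists a b, [/\ tproj a = x, tproj b = y & r = enorm (a - b)]].

End Torus.

(* The index set I = {1, ..., m} with m = n + 1, as a discrete space. *)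
Definition idx (n : nat) := discrete_topology 'I_n.+1.
HB.instance Definition _ (n : nat) := Topological.on (idx n).
HB.instance Definition _ (n : nat) := isPointed.Build (idx n) ord0.

Notation base R d n := (torus R d * idx n)%type.
Notation phase R d n := (torus R d * 'rV[R]_d * idx n)%type.
Notation borelType X := (g_sigma_algebraType (@open X)).

Definition supp (R : realType) (X : topologicalType) (nu : set X -> \bar R) :
    set X :=
  [set x | forall U, open_nbhs x U -> (0 < nu U)%E].

Definition unif_lim_pinfty (R : realType) (d n : nat)
    (F : torus R d -> 'rV[R]_d -> 'I_n.+1 -> R) : Prop :=
  forall A : R, exists r : R, forall x i p, r <= enorm p -> A <= F x p i.

Definition torus_lipschitz (R : realType) (d n : nat)
    (v : torus R d -> 'I_n.+1 -> R) : Prop :=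
  exists K : R, forall i x y, `|v x i - v y i| <= K * tdist x y.

Section System.
Variables (R : realType) (d n : nat).
Variables (H : torus R d -> 'rV[R]_d -> 'I_n.+1 -> R).
Variables (c : 'I_n.+1 -> 'I_n.+1 -> R).

Definition DxH (x : torus R d) (p : 'rV[R]_d) (i : 'I_n.+1) : 'rV[R]_d :=
  tgrad (fun y => H y p i) x.

Definition Theta (phi : torus R d -> 'I_n.+1 -> R) (x : torus R d)
    (i : 'I_n.+1) : R :=
  \sum_(j < n.+1) c i j * (phi x i - phi x j).

Definition viscosity_subsolution (v : torus R d -> 'I_n.+1 -> R) : Prop :=
  (forall i, continuous (v ^~ i)) /\
  forall i (phi : torus R d -> R) x, torus_C1 phi ->
    (forall y, v y i - phi y <= v x i - phi x) ->
    H x (tgrad phi x) i + Theta v x i <= 0.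

Definition viscosity_supersolution (v : torus R d -> 'I_n.+1 -> R) : Prop :=
  (forall i, continuous (v ^~ i)) /\
  forall i (phi : torus R d -> R) x, torus_C1 phi ->
    (forall y, v x i - phi x <= v y i - phi y) ->
    0 <= H x (tgrad phi x) i + Theta v x i.

Definition viscosity_solution (v : torus R d -> 'I_n.+1 -> R) : Prop :=
  viscosity_subsolution v /\ viscosity_supersolution v.

Definition lagrangian (x : torus R d) (q : 'rV[R]_d) (i : 'I_n.+1) : \bar R :=
  ereal_sup [set (dot p q - H x p i)%:E | p in setT].

(* A Borel probability measure is finite on compact sets, so that only inner
   regularity has to be required of a Radon one. *)
Definition radon (mu : probability (borelType (phase R d n)) R) : Prop :=
  forall A : set (borelType (phase R d n)), measurable A ->
    mu A = ereal_sup
      [set mu K | K in [set K : set (phase R d n) | compact K /\ K `<=` A]].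

Definition closed_measure (mu : probability (borelType (phase R d n)) R) :
    Prop :=
  radon mu /\
  forall phi : torus R d -> 'I_n.+1 -> R, (forall i, torus_C1 (phi ^~ i)) ->
    let g (z : phase R d n) : R :=
      let: (x, q, i) := z in dot q (tgrad (phi ^~ i) x) + Theta phi x i in
    mu.-integrable setT (EFin \o g) /\ (\int[mu]_z (g z)%:E = 0)%E.

Definition action (mu : probability (borelType (phase R d n)) R) : \bar R :=
  (\int[mu]_z lagrangian z.1.1 z.1.2 z.2)%E.

Definition mather_measures : set (probability (borelType (phase R d n)) R) :=
  [set mu | closed_measure mu /\
            forall nu, closed_measure nu -> (action mu <= action nu)%E].

Definition phase_to_base (z : borelType (phase R d n)) :
    borelType (base R d n) := (z.1.1, z.2).

Definition mather_set : set (base R d n) :=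
  closure (\bigcup_(mu in mather_measures)
             supp (pushforward mu phase_to_base)).

End System.

(* Main.v *)
(**
Suppose that v1 - v2 takes a value delta > 0. On bounded functions of (x, p, i),
x in a unit cube and p in a large box, consider the convex cone of the functions
  D_pH . Dphi + Theta phi + a l - b (v1 - v2 - delta/2),
with phi of class C^1, a, b >= 0 and l(x, p, i) = p . D_pH - H = L(x, D_pH, i).
No element of the cone is bounded below by a positive constant: mixing a smooth
approximate subsolution w near v1 (Lasry-Lions regularization, using the convexity
of H in p) with -phi would give a test function touching v2 from below at which
the supersolution inequality for v2 fails. By Hahn-Banach there is a positive
normalized functional that is nonpositive on the cone; it is represented by a
Radon probability measure, whose image nu under (x, p, i) |-> (x, D_pH, i) is
closed with action at most 0. Conversely L(x, q, i) >= q . Dw - H(x, Dw, i)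
shows that every closed measure has nonnegative action, so nu is a Mather measure.
The integral of v1 - v2 against nu is at least delta/2, whereas v1 = v2 on the
support of its marginal: a contradiction. Exchanging v1 and v2 gives equality.
*)
Require Import Defs.
From HB Require Import structures.
From mathcomp Require Import all_boot all_order all_algebra finmap.
From mathcomp Require Import all_classical all_reals all_analysis.
From mathcomp Require Import measurable_realfun ring lra.
Import Order.TTheory GRing.Theory Num.Theory.
Import numFieldNormedType.Exports.
Set Implicit Arguments.
Unset Strict Implicit.
Unset Printing Implicit Defensive.
Local Open Scope classical_set_scope.
Local Open Scope ring_scope.

(** * A positive functional separating a convex cone from the constant 1 *)

(** The construction takes place in the momentum variable. Velocities range over an unbounded space,
    whereas the gradients used against v2 are bounded in terms of the Lipschitz constant of v1, so p
    may be confined to a compact box and no mass escapes; velocities return through q = D_pH(x, p,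
    i), where Fenchel's inequality is an equality. The functional acts on all bounded functions,
    hence on indicators, and yields a set function before any measure exists. It is carried by a
    cube of R^d, and the torus enters only as the image under a continuous map. The delicate
    estimate excludes a uniformly positive element of the cone: mixing with weight e gains only a
    multiple of e, so the approximate subsolution must be accurate to order e^2, with a gradient
    bound independent of the accuracy. Lasry-Lions regularization gives both and stays pointwise:
    supergradients at nearby points take the place of almost everywhere gradients. *)

Section HahnBanach.
Variables (R : realType) (X : Type) (S : (X -> R) -> Prop).
Hypothesis S_zero : S (fun=> 0).
Hypothesis S_add : forall f g, S f -> S g -> S (fun x => f x + g x).
Hypothesis S_scale : forall t f, S f -> S (fun x => t * f x).

(** Only inequalities are required, since these pass to the infima taken below; the matching
    equalities are recovered in [hahn_banach]. *)
Definition sublinear (q : (X -> R) -> R) :=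
  [/\ q (fun=> 0) <= 0,
      forall f g, S f -> S g -> q (fun x => f x + g x) <= q f + q g &
      forall t f, 0 < t -> S f -> q (fun x => t * f x) <= t * q f].

(** Used with a fixed majorant of [q] at [-f], this keeps the infimum over a chain finite. *)
Lemma sublinear_geN (q : (X -> R) -> R) f :
  sublinear q -> S f -> - q (fun x => -1 * f x) <= q f.
Proof.
move=> [q0 qD qZ] Sf; rewrite lerNl -subr_ge0 opprK.
have q00 : 0 <= q (fun=> 0).
  have := qD _ _ S_zero S_zero; rewrite (_ : (fun=> _) = fun=> 0); first by lra.
  by apply/funext => x; rewrite addr0.
apply: le_trans q00 _; rewrite addrC.
have := qD _ _ Sf (S_scale (-1) Sf).
by rewrite (_ : (fun x => _ + _) = fun=> 0)//; apply/funext => x; ring.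
Qed.

Lemma minimal_sublinear p : sublinear p ->
  exists q, [/\ sublinear q, forall f, S f -> q f <= p f &
    forall r, sublinear r -> (forall f, S f -> r f <= q f) ->
      forall f, S f -> q f <= r f].
Proof.
move=> psub.
pose T := {q : (X -> R) -> R | `[< sublinear q /\ forall f, S f -> q f <= p f >]}.
have TP (q : T) : sublinear (sval q) /\ forall f, S f -> sval q f <= p f.
  by apply/asboolP; exact: (svalP q).
have p0P : `[< sublinear p /\ forall f, S f -> p f <= p f >] by apply/asboolP; split.
pose r (a b : T) := `[< forall f, S f -> sval b f <= sval a f >].
have rP a b : r a b -> forall f, S f -> sval b f <= sval a f by move/asboolP.
(* Functionals are compared on [S] only, so distinct ones may precede each other: the order is
   merely a preorder. *)
have [||A totA|q qmax] := @ZL_preorder T (exist _ p p0P) r.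
- by move=> t; apply/asboolP => f _.
- move=> a b c /rP ab /rP bc; apply/asboolP => f Sf.
  exact: le_trans (bc f Sf) (ab f Sf).
- have [[a0 Aa0]|An] := pselect (exists a, A a); last first.
    by exists (exist _ p p0P) => s As; case: An; exists s.
  pose E f := [set sval a f | a in A].
  have E0 f : E f !=set0 by exists (sval a0 f), a0.
  have Elb f : S f -> has_lbound (E f).
    move=> Sf; exists (- p (fun x => -1 * f x)) => _ [a Aa <-].
    have [sa ap] := TP a.
    by apply: le_trans (sublinear_geN sa Sf); rewrite lerN2 ap//; exact: S_scale.
  have Ele f a : S f -> A a -> inf (E f) <= sval a f.
    by move=> Sf Aa; apply: ge_inf; [exact: Elb|exists a].
  have iP : sublinear (fun f => inf (E f)) /\ forall f, S f -> inf (E f) <= p f.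
    split; last first.
      by move=> f Sf; apply: le_trans (Ele f a0 Sf Aa0) _; have [_] := TP a0; exact.
    split.
    + by apply: le_trans (Ele _ a0 S_zero Aa0) _; have [[]] := TP a0.
    + move=> f g Sf Sg; rewrite -lerBlDr; apply: lb_le_inf => // _ [a Aa <-].
      rewrite lerBlDl -lerBlDr; apply: lb_le_inf => // _ [b Ab <-].
      rewrite lerBlDr.
      (* Of two members of the chain the smaller one serves for both arguments; this makes the
         infimum subadditive. *)
      have [c [Ac ca cb]] : exists c, [/\ A c, r a c & r b c].
        have [ab|ba] := totA _ _ Aa Ab; [exists b|exists a]; split => //;
        by apply/asboolP.
      apply: le_trans (Ele _ c (S_add Sf Sg) Ac) _.
      have [[_ cD _] _] := TP c.
      by apply: le_trans (cD _ _ Sf Sg) _; rewrite addrC; apply: lerD; [exact: (rP _ _ cb)|exact: (rP _ _ ca)].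
    + move=> t f t0 Sf; rewrite mulrC -ler_pdivrMr//; apply: lb_le_inf => // _ [a Aa <-].
      rewrite ler_pdivrMr// mulrC; apply: le_trans (Ele _ a (S_scale t Sf) Aa) _.
      by have [[_ _ aZ] _] := TP a; exact: aZ.
  have iP' : `[< sublinear (fun f => inf (E f)) /\ forall f, S f -> inf (E f) <= p f >].
    exact/asboolP.
  pose t0 : T := exist _ (fun f => inf (E f)) iP'.
  by exists t0 => a Aa; apply/asboolP => f Sf /=; exact: Ele.
- exists (sval q); have [qs qp] := TP q; split => // s ss sq.
  have sP : `[< sublinear s /\ forall f, S f -> s f <= p f >].
    by apply/asboolP; split => // f Sf; apply: le_trans (sq _ Sf) (qp _ Sf).
  have /qmax/rP : r q (exist _ s sP) by apply/asboolP.
  exact.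
Qed.

(* A minimal sublinear q is additive: h |-> inf_(t >= 0) (q (h + t g) - t q g)
   is sublinear and below q, hence equal to q. *)
Lemma hahn_banach p : sublinear p ->
  exists L, [/\ forall f, S f -> L f <= p f,
    forall f g, S f -> S g -> L (fun x => f x + g x) = L f + L g &
    forall t f, S f -> L (fun x => t * f x) = t * L f].
Proof.
move=> psub; have [q [qs qp qmin]] := minimal_sublinear psub.
have [q0 qD qZ] := qs.
have qZe t f : 0 < t -> S f -> q (fun x => t * f x) = t * q f.
  move=> t0 Sf; apply/eqP; rewrite eq_le qZ//=.
  have ti : 0 < t^-1 by rewrite invr_gt0.
  have := qZ _ _ ti (S_scale t Sf).
  rewrite (_ : (fun x => _ * (_ * _)) = f); last first.
    by apply/funext => x; rewrite mulrA mulVf ?mul1r// gt_eqF.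
  by rewrite mulrC ler_pdivlMr// mulrC.
have q00 : q (fun=> 0) = 0.
  apply/eqP; rewrite eq_le q0/=.
  have := qD _ _ S_zero S_zero; rewrite (_ : (fun=> _) = fun=> 0); first by lra.
  by apply/funext => x; rewrite addr0.
have qDe f g : S f -> S g -> q (fun x => f x + g x) = q f + q g.
  move=> Sf Sg; apply/eqP; rewrite eq_le qD//=.
  pose E h := [set q (fun x => h x + t * g x) - t * q g | t in [set t : R | 0 <= t]].
  have E0 h : E h !=set0 by exists (q (fun x => h x + 0 * g x) - 0 * q g), 0 => //=.
  have Elb h : S h -> has_lbound (E h).
    move=> Sh; exists (- q (fun x => -1 * h x)) => _ [t /= t0 <-].
    have Sth := S_add Sh (S_scale t Sg).
    have := qD _ _ Sth (S_scale (-1) Sh).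
    rewrite (_ : (fun x => _ + -1 * _) = fun x => t * g x); last by apply/funext => x; ring.
    have {t0}[t0|] : 0 < t \/ t = 0 by have := t0 : 0 <= t; lra.
      by rewrite qZe//; lra.
    move=> ->.
    rewrite mul0r (_ : (fun x => 0 * g x) = fun=> 0); first by rewrite q00//; lra.
    by apply/funext => x; rewrite mul0r.
  have Ele h t : S h -> 0 <= t -> inf (E h) <= q (fun x => h x + t * g x) - t * q g.
    by move=> Sh t0; apply: ge_inf; [exact: Elb|exists t].
  have Eq h : S h -> inf (E h) <= q h.
    move=> Sh; apply: le_trans (Ele h 0 Sh (lexx _)) _; rewrite mul0r subr0.
    by rewrite (_ : (fun x => _) = h)//; apply/funext => x; rewrite mul0r addr0.
  have Es : sublinear (fun h => inf (E h)).
    split.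
    - by apply: le_trans (Eq _ S_zero) q0.
    - move=> h k Sh Sk; rewrite -lerBlDr; apply: lb_le_inf => // _ [t /= t0 <-].
      rewrite lerBlDl -lerBlDr; apply: lb_le_inf => // _ [s /= s0 <-].
      rewrite lerBlDr; apply: le_trans (Ele _ (t + s) (S_add Sh Sk) _) _; first lra.
      have := qD _ _ (S_add Sh (S_scale t Sg)) (S_add Sk (S_scale s Sg)).
      rewrite (_ : (fun x => (h x + t * g x) + _) = (fun x => h x + k x + (t + s) * g x)); first lra.
      by apply/funext => x; ring.
    - move=> t h t0 Sh; rewrite mulrC -ler_pdivrMr//; apply: lb_le_inf => // _ [s /= s0 <-].
      rewrite ler_pdivrMr//; apply: le_trans (Ele _ (t * s) (S_scale t Sh) _) _.
        by rewrite mulr_ge0// ltW.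
      have := qZ _ _ t0 (S_add Sh (S_scale s Sg)).
      rewrite (_ : (fun x => t * (h x + s * g x)) = (fun x => t * h x + t * s * g x)); first lra.
      by apply/funext => x; ring.
  have := qmin _ Es Eq f Sf; have := Ele f 1 Sf ler01.
  rewrite (_ : (fun x => f x + 1 * g x) = fun x => f x + g x); first lra.
  by apply/funext => x; rewrite mul1r.
exists q; split => // t f Sf.
have qN : q (fun x => -1 * f x) = - q f.
  have := qDe _ _ Sf (S_scale (-1) Sf).
  rewrite (_ : (fun x => _ + _) = fun=> 0); first by rewrite q00//; lra.
  by apply/funext => x; ring.
have [t0|t0|->] := ltgtP t 0; last 2 first.
- exact: qZe.
- rewrite mul0r (_ : (fun x => _) = fun=> 0) ?q00//.
  by apply/funext => x; rewrite mul0r.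
have tN : 0 < - t by lra.
have := qZe _ _ tN (S_scale (-1) Sf); rewrite qN.
rewrite (_ : (fun x => - t * _) = fun x => t * f x); first by move=> ->; lra.
by apply/funext => x; ring.
Qed.

End HahnBanach.

Section PositiveFunctional.
Variables (R : realType) (X : Type) (D : set X).

Definition bounded_on (f : X -> R) := exists M, forall x, D x -> `|f x| <= M.

Lemma bounded_onD f g :
  bounded_on f -> bounded_on g -> bounded_on (fun x => f x + g x).
Proof.
move=> [M fM] [N gN]; exists (M + N) => x Dx.
by apply: le_trans (ler_normD _ _) _; apply: lerD; [exact: fM|exact: gN].
Qed.

Lemma bounded_onZ t f : bounded_on f -> bounded_on (fun x => t * f x).
Proof.
by move=> [M fM]; exists (`|t| * M) => x Dx; rewrite normrM ler_wpM2l// fM.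
Qed.

Lemma bounded_on_cst (a : R) : bounded_on (fun=> a).
Proof. by exists `|a|. Qed.

(** Positivity, normalization and the sign on [C] all follow from bounds on one sublinear majorant.
    The last hypothesis on [C] makes this majorant finite: if |f| <= M and t < -M, then f <= t + g
    would make g uniformly positive on [D]. *)
Lemma positive_functional (C : (X -> R) -> Prop) :
  (forall g, C g -> bounded_on g) -> C (fun=> 0) ->
  (forall g h, C g -> C h -> C (fun x => g x + h x)) ->
  (forall t g, 0 < t -> C g -> C (fun x => t * g x)) ->
  (forall g eta, C g -> 0 < eta -> exists2 x, D x & g x < eta) ->
  exists L : (X -> R) -> R,
    [/\ forall f g, bounded_on f -> bounded_on g ->
          L (fun x => f x + g x) = L f + L g,
        forall t f, bounded_on f -> L (fun x => t * f x) = t * L f,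
        forall f, bounded_on f -> (forall x, D x -> 0 <= f x) -> 0 <= L f,
        L (fun=> 1) = 1 &
        forall g, C g -> L g <= 0].
Proof.
move=> Cb C0 CD CZ Cs.
(* The majorant is f |-> inf {t | f <= t + g on D for some g in C}. *)
pose E f := [set t : R | exists2 g, C g & forall x, D x -> f x <= t + g x].
have E0 f : bounded_on f -> E f !=set0.
  move=> [M fM]; exists M, (fun=> 0) => // x Dx; rewrite addr0.
  exact: le_trans (ler_norm _) (fM x Dx).
have Elb f : bounded_on f -> has_lbound (E f).
  move=> [M fM]; exists (- M) => t [g Cg fg]; rewrite leNgt; apply/negP => tM.
  have e0 : 0 < - M - t by lra.
  have [x Dx] := Cs _ _ Cg e0; have := fg x Dx; have := fM x Dx.
  by rewrite ler_norml => /andP[]; lra.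
have Ele f t : bounded_on f -> E f t -> inf (E f) <= t.
  by move=> bf Et; apply: ge_inf => //; exact: Elb.
have Es : sublinear bounded_on (fun f => inf (E f)).
  split.
  - apply: Ele; first exact: bounded_on_cst.
    by exists (fun=> 0) => // x _; rewrite addr0.
  - move=> f g bf bg; rewrite -lerBlDr; apply: lb_le_inf; first exact: E0.
    move=> t [h Ch fh]; rewrite lerBlDl -lerBlDr; apply: lb_le_inf; first exact: E0.
    move=> s [k Ck gk]; rewrite lerBlDr; apply: Ele; first exact: bounded_onD.
    exists (fun x => h x + k x); first exact: CD.
    by move=> x Dx; have := fh x Dx; have := gk x Dx; lra.
  - move=> t f t0 bf; rewrite mulrC -ler_pdivrMr//; apply: lb_le_inf; first exact: E0.
    move=> s [h Ch fh]; rewrite ler_pdivrMr// mulrC.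
    apply: Ele; first exact: bounded_onZ.
    exists (fun x => t * h x); first exact: CZ.
    by move=> x Dx; rewrite -mulrDr ler_pM2l// fh.
have [L [Lp LD LZ]] := hahn_banach (bounded_on_cst 0) bounded_onD bounded_onZ Es.
have LN f : bounded_on f -> L (fun x => -1 * f x) = - L f.
  by move=> bf; rewrite LZ// mulN1r.
exists L; split => //.
- move=> f bf f0; rewrite -oppr_le0 -LN//.
  apply: le_trans (Lp _ (bounded_onZ _ bf)) _; apply: Ele; first exact: bounded_onZ.
  by exists (fun=> 0) => // x Dx; have := f0 x Dx; lra.
- apply/eqP; rewrite eq_le; apply/andP; split.
    apply: le_trans (Lp _ (bounded_on_cst _)) _; apply: Ele; first exact: bounded_on_cst.
    by exists (fun=> 0) => // x Dx; rewrite addr0.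
  rewrite -lerN2 -LN; last exact: bounded_on_cst.
  apply: le_trans (Lp _ (bounded_onZ _ (bounded_on_cst _))) _.
  apply: Ele; first exact/bounded_onZ/bounded_on_cst.
  by exists (fun=> 0) => // x Dx; lra.
- move=> g Cg; apply: le_trans (Lp _ (Cb _ Cg)) _; apply: Ele; first exact: Cb.
  by exists g => // x Dx; rewrite add0r.
Qed.

End PositiveFunctional.

(** * Periodic smooth test functions *)

Section Trig.
Variable R : realType.
Implicit Types (x t a b : R).

Lemma ge0_of_derive (f df : R -> R) : (forall x, is_derive x 1 f (df x)) ->
  f 0 = 0 -> (forall x, 0 <= x -> 0 <= df x) -> forall x, 0 <= x -> 0 <= f x.
Proof.
move=> fdf f0 df0 x x0.
have [|c] := @MVT_segment R f df 0 x x0 (fun y _ => fdf y).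
  apply: continuous_subspaceT => y.
  exact/differentiable_continuous/derivable1_diffP.
by rewrite in_itv/= => /andP[c0 _]; rewrite f0 !subr0 => ->; rewrite mulr_ge0// df0.
Qed.

Lemma sin_le_id x : 0 <= x -> sin x <= x.
Proof.
move=> x0; rewrite -subr_ge0.
apply: (@ge0_of_derive (fun y => y - sin y) (fun y => 1 - cos y)) => //.
- by rewrite sin0 subr0.
Qed.

Lemma one_sub_cos_le x : 1 - cos x <= x ^+ 2 / 2.
Proof.
wlog x0 : x / 0 <= x => [h|].
  by case: (leP 0 x) => [/h//|x0]; rewrite -cosN -sqrrN h//; lra.
rewrite -subr_ge0.
apply: (@ge0_of_derive (fun y => y ^+ 2 / 2 - (1 - cos y)) (fun y => y - sin y)) => //.
- move=> y; apply: is_derive_eq; rewrite /GRing.scale/=; lra.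
- by rewrite cos0; lra.
- by move=> y y0; rewrite subr_ge0 sin_le_id.
Qed.

Lemma normr_id_sub_sin_le x : `|x - sin x| <= x ^+ 2 / 2.
Proof.
wlog x0 : x / 0 <= x => [h|].
  case: (leP 0 x) => [/h//|x0]; rewrite -sqrrN -normrN.
  by rewrite (_ : - (x - sin x) = - x - sin (- x)) ?h ?sinN//; lra.
rewrite ger0_norm ?subr_ge0 ?sin_le_id// -subr_ge0.
apply: (@ge0_of_derive (fun y => y ^+ 2 / 2 - (y - sin y)) (fun y => y - (1 - cos y))) => //.
- move=> y; apply: is_derive_eq; rewrite /GRing.scale/=; lra.
- by rewrite sin0; lra.
- apply: (@ge0_of_derive (fun y => y - (1 - cos y)) (fun y => 1 - sin y)) => //.
  + move=> y; apply: is_derive_eq; lra.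
  + by rewrite cos0; lra.
Qed.

Lemma one_sub_cos_ge x : `|x| <= pi -> x ^+ 2 / 32 <= 1 - cos x.
Proof.
rewrite -cos_norm -real_normK ?num_real//; have := normr_ge0 x.
move: `|x| => {}x x0 xpi.
have p4 : pi <= 4 :> R by have := @pihalf_lt2 R; lra.
have [x2|x2] := leP x 2.
  rewrite (_ : x = (x / 2) *+ 2); last by rewrite mulr2n; lra.
  rewrite cos_mulr2n; have := cos2Dsin2 (x / 2).
  have := normr_id_sub_sin_le (x / 2); rewrite ler_norml => /andP[_].
  set s := sin _; set c := cos _ => h1 h2.
  have h3 : x / 4 <= s by nra.
  rewrite !mulr2n (_ : x / 2 + x / 2 = x); nra.
have c2 : cos x <= cos 2.
  have := @pi_ge2 R => p2.
  rewrite ltW// ltr_cos// in_itv/=; apply/andP; split; lra.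
have := @cos2_lt0 R; nra.
Qed.

Lemma sin_taylor2 a b : `|sin (a + b) - sin a - cos a * b| <= b ^+ 2.
Proof.
rewrite sinD (_ : _ - _ = - (sin a * (1 - cos b)) - cos a * (b - sin b)); last ring.
apply: le_trans (ler_normB _ _) _; rewrite normrN !normrM.
have h1 : `|1 - cos b| <= b ^+ 2 / 2.
  by rewrite ger0_norm ?one_sub_cos_le// subr_ge0 cos_le1.
have h2 := normr_id_sub_sin_le b.
have h3 := @sin_max R a; have h4 := @cos_max R a.
have := normr_ge0 (1 - cos b); have := normr_ge0 (b - sin b); nra.
Qed.

Lemma cos_taylor2 a b : `|cos (a + b) - cos a + sin a * b| <= b ^+ 2.
Proof.
rewrite cosD (_ : _ + _ = - (cos a * (1 - cos b)) + sin a * (b - sin b)); last ring.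
apply: le_trans (ler_normD _ _) _; rewrite normrN !normrM.
have h1 : `|1 - cos b| <= b ^+ 2 / 2.
  by rewrite ger0_norm ?one_sub_cos_le// subr_ge0 cos_le1.
have h2 := normr_id_sub_sin_le b.
have h3 := @sin_max R a; have h4 := @cos_max R a.
have := normr_ge0 (1 - cos b); have := normr_ge0 (b - sin b); nra.
Qed.

Lemma periodic_int (f : R -> R) (T : R) : (forall a, f (a + T) = f a) ->
  forall (z : int) a, f (a + z%:~R * T) = f a.
Proof.
move=> fT; have fn (n : nat) a : f (a + n%:R * T) = f a.
  elim: n a => [|n IH] a; first by rewrite mul0r addr0.
  by rewrite -natr1 mulrDl mul1r addrA fT.
case=> n a; first exact: fn.
by rewrite NegzE mulrNz mulNr -(fn n.+1 (a - _)) subrK.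
Qed.

(** A viscosity test function on the torus must be periodic, which a paraboloid is not. This is a
    one-dimensional substitute with the same value and slope at 0, above the parabola on a whole
    period; its quadratic remainder bound will make it C^1. *)
Lemma periodic_quadratic_bump (q k : R) : 0 <= k ->
  exists (psi dpsi : R -> R) (C : R),
    [/\ psi 0 = 0 /\ dpsi 0 = q,
        0 <= C /\ forall t h, `|psi (t + h) - psi t - dpsi t * h| <= C * h ^+ 2,
        forall (z : int) t, psi (t + z%:~R) = psi t &
        forall t, `|t| <= 2^-1 -> q * t + k * t ^+ 2 <= psi t].
Proof.
move=> k0; pose w : R := 2 * pi; have w0 : 0 < w by have := @pi_gt0 R; rewrite /w; lra.
have w1 : 1 <= w by have := @pi_ge2 R; rewrite /w; lra.
have [b bw] : exists b, b * w = q by exists (q / w); rewrite divfK// gt_eqF.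
(* With s = w t, the sine term misses its tangent by at most |b| s^2 / 2. The factor 32 comes from
   [one_sub_cos_ge]: it makes A (1 - cos s) at least (|b| + k) s^2, which pays for this and for k
   t^2, since w >= 1. *)
have [A [AE A0]] : exists A : R, A = 32 * (`|b| + k) /\ 0 <= A.
  by eexists; split; [reflexivity|rewrite mulr_ge0// addr_ge0].
exists (fun t => b * sin (w * t) + A * (1 - cos (w * t))).
exists (fun t => q * cos (w * t) + A * w * sin (w * t)).
exists ((`|b| + A) * w ^+ 2); split.
- by rewrite mulr0 sin0 cos0; split; ring.
- split; first by rewrite mulr_ge0 ?sqr_ge0// addr_ge0.
  move=> t h; rewrite mulrDr -bw; set a := w * t; set e := w * h.
  rewrite [X in `|X|](_ : _ = b * (sin (a + e) - sin a - cos a * e) - A * (cos (a + e) - cos a + sin a * e)); last first.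
    by rewrite /e; ring.
  apply: le_trans (ler_normB _ _) _; rewrite !normrM (ger0_norm A0).
  rewrite -mulrA -exprMn -/e mulrDl; apply: lerD; rewrite ler_wpM2l//.
    exact: sin_taylor2.
  exact: cos_taylor2.
- move=> z t; rewrite mulrDr (_ : w * z%:~R = z%:~R * w); last by rewrite mulrC.
  have wE : w = pi *+ 2 by rewrite /w mulr2n; lra.
  by rewrite wE (periodic_int (@cosD2pi R)) (periodic_int (@sinD2pi R)).
- move=> t t2; set s := w * t.
  have sp : `|s| <= pi.
    by rewrite /s normrM (gtr0_norm w0) /w; have := @pi_gt0 R; nra.
  have h1 := one_sub_cos_ge sp; have := normr_id_sub_sin_le s => h2.
  have -> : q * t = b * s by rewrite /s -bw; ring.
  have h3 : k * t ^+ 2 <= k * s ^+ 2.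
    rewrite ler_wpM2l// /s exprMn ler_peMl ?sqr_ge0//; nra.
  have h4 : b * (s - sin s) <= `|b| * (s ^+ 2 / 2).
    apply: le_trans (ler_norm _) _; rewrite normrM ler_wpM2l//.
  have h5 : (`|b| + k) * s ^+ 2 <= A * (1 - cos s).
    by rewrite AE; have := normr_ge0 b; nra.
  have h6 : `|b| * (s ^+ 2 / 2) <= `|b| * s ^+ 2.
    by rewrite ler_wpM2l//; have := sqr_ge0 s; lra.
  lra.
Qed.
End Trig.

(** * Continuity, Euclidean geometry and differentiability *)

(* Stated for an abstract topological space: on row vectors the unifier
   unfolds the neighbourhood filter when the pointwise lemmas are applied. *)
Section ContinuousFun.
Variables (R : realType) (T : topologicalType) (V : normedModType R).

Lemma continuous_funB (f g : T -> V) :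
  continuous f -> continuous g -> continuous (fun x => f x - g x).
Proof. by move=> cf cg x; apply: cvgB; [exact: cf|exact: cg]. Qed.

Lemma continuous_funD (f g : T -> V) :
  continuous f -> continuous g -> continuous (fun x => f x + g x).
Proof. by move=> cf cg x; apply: cvgD; [exact: cf|exact: cg]. Qed.

Lemma continuous_fun_cst (a : V) : continuous (fun _ : T => a).
Proof. by move=> x; exact: cvg_cst. Qed.

Lemma continuous_funM (f g : T -> R) :
  continuous f -> continuous g -> continuous (fun x => f x * g x).
Proof. by move=> cf cg x; apply: cvgM; [exact: cf|exact: cg]. Qed.

Lemma continuous_fun_sum n (F : 'I_n -> T -> R) :
  (forall j, continuous (F j)) -> continuous (fun x => \sum_(j < n) F j x).
Proof.
move=> cF x; apply: cvg_big; [exact: add_continuous|by move=> j _; exact: cF].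
Qed.

Lemma continuous_fun_comp (U W : topologicalType) (f : T -> U) (g : U -> W) :
  continuous f -> continuous g -> continuous (fun x => g (f x)).
Proof. by move=> cf cg x; apply: continuous_comp; [exact: cf|exact: cg]. Qed.

End ContinuousFun.

Lemma lipschitz_fun_continuous (R : realType) (V : normedModType R)
    (f : V -> R) (L : R) :
  (forall x y, `|f x - f y| <= L * `|x - y|) -> continuous f.
Proof.
move=> fL x; apply/cvgrPdist_le => e e0.
near=> y; apply: le_trans (fL _ _) _.
have L0 : 0 < `|L| + 1 by rewrite ltr_pwDr.
apply: (@le_trans _ _ ((`|L| + 1) * `|x - y|)).
  by rewrite ler_wpM2r// ler_wpDr// ler_norm.
rewrite -ler_pdivlMl//; near: y.
by apply: cvgr_dist_le => //; rewrite mulr_gt0 ?invr_gt0.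
Unshelve. all: by end_near. Qed.

Lemma continuous_row_coord (R : realType) d j :
  continuous (fun x : 'rV[R]_d => x 0 j).
Proof. by move=> x; exact: coord_continuous. Qed.

Lemma continuous_dot (R : realType) d (T : topologicalType) (f g : T -> 'rV[R]_d) :
  continuous f -> continuous g -> continuous (fun x => dot (f x) (g x)).
Proof.
move=> cf cg; rewrite /dot; apply: continuous_fun_sum => j.
by apply: continuous_funM;
  [exact: (continuous_fun_comp cf (@continuous_row_coord R d j))
  |exact: (continuous_fun_comp cg (@continuous_row_coord R d j))].
Qed.

Section Euclid.
Variables (R : realType) (d : nat).
Implicit Types (u v w : 'rV[R]_d) (a : R).

Lemma dotC u v : dot u v = dot v u.
Proof. by apply: eq_bigr => j _; rewrite mulrC. Qed.

Lemma dotDl u v w : dot (u + v) w = dot u w + dot v w.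
Proof. by rewrite -big_split/=; apply: eq_bigr => j _; rewrite mxE mulrDl. Qed.

Lemma dotZl a u v : dot (a *: u) v = a * dot u v.
Proof. by rewrite /dot mulr_sumr; apply: eq_bigr => j _; rewrite mxE mulrA. Qed.

Lemma dotDr u v w : dot w (u + v) = dot w u + dot w v.
Proof. by rewrite dotC dotDl !(dotC w). Qed.

Lemma dotZr a u v : dot v (a *: u) = a * dot v u.
Proof. by rewrite dotC dotZl dotC. Qed.

Lemma dotNl u v : dot (- u) v = - dot u v.
Proof. by rewrite -scaleN1r dotZl mulN1r. Qed.

Lemma dotNr u v : dot u (- v) = - dot u v.
Proof. by rewrite dotC dotNl dotC. Qed.

Definition dotE := (dotDl, dotDr, dotNl, dotNr, dotZl, dotZr).

Lemma dot0l u : dot 0 u = 0.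
Proof. by rewrite -(scale0r u) dotZl mul0r. Qed.

Lemma dot0r u : dot u 0 = 0.
Proof. by rewrite dotC dot0l. Qed.

Lemma dot_ge0 u : 0 <= dot u u.
Proof. by apply: sumr_ge0 => j _; rewrite -expr2 sqr_ge0. Qed.

Lemma dot_delta u j : dot u (delta_mx 0 j) = u 0 j.
Proof.
rewrite /dot (bigD1 j)//= mxE !eqxx mulr1 big1 ?addr0// => k kj.
by rewrite mxE (negbTE kj) andbF mulr0.
Qed.

Lemma sqr_coord_le_dot u j : u 0 j ^+ 2 <= dot u u.
Proof.
rewrite /dot (bigD1 j)//= -expr2 lerDl; apply: sumr_ge0 => k _.
by rewrite -expr2 sqr_ge0.
Qed.

Lemma enorm_ge0 u : 0 <= enorm u. Proof. exact: sqrtr_ge0. Qed.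

Lemma enorm_sqr u : enorm u ^+ 2 = dot u u.
Proof. by rewrite sqr_sqrtr// dot_ge0. Qed.

Lemma enormN u : enorm (- u) = enorm u.
Proof. by rewrite /enorm dotNl dotNr opprK. Qed.

Lemma enormZ a u : enorm (a *: u) = `|a| * enorm u.
Proof. by rewrite /enorm dotZl dotZr mulrA -expr2 sqrtrM ?sqr_ge0// sqrtr_sqr. Qed.

Lemma normr_dot_le u v : `|dot u v| <= enorm u * enorm v.
Proof.
rewrite -sqrtrM ?dot_ge0// -(sqrtr_sqr (dot u v)) ler_sqrt; last first.
  by rewrite mulr_ge0// dot_ge0.
have uu := dot_ge0 u; have vv := dot_ge0 v.
have h t : 0 <= dot u u - 2 * t * dot u v + t ^+ 2 * dot v v.
  by have := dot_ge0 (u - t *: v); rewrite !dotE (dotC v u); lra.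
have [v0|v0] := eqVneq (dot v v) 0; last first.
  have := h (dot u v / dot v v).
  have vp : 0 < dot v v by rewrite lt_neqAle eq_sym v0.
  rewrite (_ : _ + _ = dot u u - dot u v ^+ 2 / dot v v); last by field.
  by rewrite subr_ge0 ler_pdivrMr.
have [uv0|uv0] := eqVneq (dot u v) 0; first by rewrite uv0 v0 mulr0 expr0n.
(* With dot v v = 0 the nonnegative quadratic is affine in t, and this t gives it the value -1. *)
have := h ((dot u u + 1) / (2 * dot u v)); rewrite v0 mulr0 addr0.
have -> : 2 * ((dot u u + 1) / (2 * dot u v)) * dot u v = dot u u + 1 by field.
lra.
Qed.

Lemma dot_le_enorm u v : dot u v <= enorm u * enorm v.
Proof. exact: le_trans (ler_norm _) (normr_dot_le u v). Qed.

Lemma enormD u v : enorm (u + v) <= enorm u + enorm v.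
Proof.
rewrite -ler_sqr ?nnegrE ?addr_ge0 ?enorm_ge0//.
rewrite enorm_sqr !dotE (dotC v u) -!enorm_sqr; have := dot_le_enorm u v; lra.
Qed.

Lemma normr_coord_le_enorm u j : `|u 0 j| <= enorm u.
Proof. by rewrite -sqrtr_sqr ler_sqrt ?sqr_coord_le_dot// dot_ge0. Qed.

Lemma normr_coord_le u j : `|u 0 j| <= `|u|.
Proof. by rewrite [leRHS]mx_normrE; apply: (le_bigmax _ _ (0, j)). Qed.

Lemma dot_le_normr u : dot u u <= d%:R * `|u| ^+ 2.
Proof.
apply: (@le_trans _ _ (\sum_(j < d) `|u| ^+ 2)); last first.
  by rewrite sumr_const card_ord mulr_natl.
apply: ler_sum => j _; rewrite -expr2 -real_normK ?num_real//.
by rewrite ler_sqr ?nnegrE// normr_coord_le.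
Qed.

Lemma enorm_le_normr u : enorm u <= Num.sqrt d%:R * `|u|.
Proof.
apply: (@le_trans _ _ (Num.sqrt (d%:R * `|u| ^+ 2))).
  by rewrite ler_sqrt ?dot_le_normr// mulr_ge0// sqr_ge0.
by rewrite sqrtrM// sqrtr_sqr normr_id.
Qed.

Definition elipschitz (K : R) (f : 'rV[R]_d -> R) :=
  forall x y, `|f x - f y| <= K * enorm (x - y).

Lemma elipschitz_continuous (K : R) (f : 'rV[R]_d -> R) : elipschitz K f -> continuous f.
Proof.
move=> fK; apply: (@lipschitz_fun_continuous _ _ _ (`|K| * Num.sqrt d%:R)) => x y.
apply: le_trans (fK _ _) _.
have := enorm_le_normr (x - y); have := enorm_ge0 (x - y).
have := ler_norm K; have := normr_ge0 K; nra.
Qed.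

Lemma compact_box (y : 'rV[R]_d) (r : R) :
  compact [set z : 'rV[R]_d | forall j, y 0 j - r <= z 0 j <= y 0 j + r].
Proof.
have := @rV_compact R d (fun j => `[y 0 j - r, y 0 j + r]%classic)
  (fun j => @segment_compact _ _ _).
by congr compact; apply/seteqP; split => z /= h j; have := h j; rewrite /= in_itv.
Qed.

(** Outside the box of radius K / k the penalty outweighs the Lipschitz gain, so a maximum over the
    box is global; comparison with the value at y then bounds the distance. *)
Lemma sup_conv_attained (K k : R) (f : 'rV[R]_d -> R) (y : 'rV[R]_d) : 0 <= K -> 0 < k -> elipschitz K f ->
  exists z, (forall w, f w - k * dot (w - y) (w - y) <= f z - k * dot (z - y) (z - y))
    /\ k * enorm (z - y) <= K.
Proof.
move=> K0 k0 fK; pose F z := f z - k * dot (z - y) (z - y).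
pose B := [set z : 'rV[R]_d | forall j, y 0 j - K / k <= z 0 j <= y 0 j + K / k].
have Kk : 0 <= K / k by rewrite divr_ge0// ltW.
have By : B y by move=> j; lra.
have cF : continuous F.
  apply: continuous_funB; first exact: elipschitz_continuous fK.
  apply: continuous_funM; first exact: continuous_fun_cst.
  by apply: continuous_dot; apply: continuous_funB; (exact: continuous_fun_cst || by move=> z; exact: cvg_id).
have FE w : F w <= f y + K * enorm (w - y) - k * enorm (w - y) ^+ 2.
  by rewrite enorm_sqr lerD2r; have := fK w y; rewrite ler_norml => /andP[_]; lra.
have B0 : B !=set0 by exists y.
have [z zB zmax] := compact_EVT_max B0 (@compact_box y (K / k)) (continuous_subspaceT cF).
have Fy : F y = f y by rewrite /F subrr dot0l mulr0 subr0.
have zm w : F w <= F z.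
  have [wB|wB] := pselect (B w); first by apply: zmax; rewrite inE.
  apply: (@le_trans _ _ (F y)); last by apply: zmax; rewrite inE.
  apply: le_trans (FE w) _; rewrite Fy -addrA gerDl subr_le0.
  suff h : K / k <= enorm (w - y).
    by move: h; rewrite ler_pdivrMr// => h; have := enorm_ge0 (w - y); nra.
  move/existsNP: wB => [j /negP]; rewrite negb_and -!ltNge => h.
  apply: le_trans (normr_coord_le_enorm (w - y) j); rewrite !mxE.
  by case/orP: h => h; [rewrite ler0_norm|rewrite ger0_norm]; lra.
exists z; split => //.
have := zm y; rewrite Fy => h; have := FE z.
have := enorm_ge0 (z - y); rewrite le_eqVlt => /predU1P[<-|e0]; first by rewrite !mulr0.
by move=> h2; rewrite -(ler_pM2r e0); lra.
Qed.

End Euclid.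

Lemma differentiable_of_quadratic (R : realType) (V : normedModType R)
    (u : V -> R) (x : V) (L : {linear V -> R}) (C : R) : continuous L -> 0 <= C ->
  (forall h, `|u (x + h) - u x - L h| <= C * `|h| ^+ 2) ->
  differentiable u x /\ 'd u x = L :> (V -> R).
Proof.
move=> cL C0 ux.
have uo : u \o shift x = cst (u x) + L +o_ 0 id.
  have C1 : 0 < C + 1 by rewrite ltr_wpDl.
  apply/eqaddoP => eps eps0; near=> h => /=.
  rewrite -[X in `|X|]/(u (h + x) - (u x + L h)).
  rewrite opprD addrA [h + x]addrC; apply: le_trans (ux h) _.
  rewrite expr2 mulrA ler_wpM2r//.
  apply: (@le_trans _ _ ((C + 1) * `|h|)); first by rewrite ler_wpM2r// lerDl.
  rewrite -ler_pdivlMl//; near: h.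
  apply: nbhs0_le; rewrite mulr_gt0 ?invr_gt0//.
have dE : 'd u x = L :> (V -> R) by exact: diff_unique.
by split => //; apply/diff_locallyP; rewrite dE.
Unshelve. all: by end_near. Qed.

Section SecondOrder.
Variables (R : realType) (d : nat).

Lemma derive_of_quadratic (u : 'rV[R]_d -> R) (x p : 'rV[R]_d) (C : R) : 0 <= C ->
  (forall h, `|u (x + h) - u x - dot p h| <= C * dot h h) ->
  differentiable u x /\ forall v, 'D_v u x = dot p v.
Proof.
move=> C0 ux.
have Llin : linear (dot p) by move=> a h k; rewrite !dotE.
pose LM := GRing.isLinear.Build _ _ _ _ (dot p) Llin.
pose Lf : {linear 'rV[R]_d -> R} := HB.pack (dot p) LM.
have cL : continuous Lf.
  by apply: continuous_dot; [exact: continuous_fun_cst|move=> z; exact: cvg_id].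
have [|h|du dE] := @differentiable_of_quadratic R 'rV[R]_d u x Lf (C * d%:R) cL.
- by rewrite mulr_ge0.
- by apply: le_trans (ux h) _; rewrite -mulrA ler_wpM2l// dot_le_normr.
by split => // v; rewrite deriveE// dE.
Qed.

(** The uniform remainder makes p Lipschitz: expand u(x + e + h) from x and from x + e, with h along
    an axis and |h| = |e|; the three remainders add up to at most 6 C |e|^2. *)
Lemma quadratic_C1 (u : 'rV[R]_d -> R) (p : 'rV[R]_d -> 'rV[R]_d) (C : R) : 0 <= C ->
  (forall x h, `|u (x + h) - u x - dot (p x) h| <= C * dot h h) ->
  is_C1 u /\ forall x, grad u x = p x.
Proof.
move=> C0 ux.
have uD x := derive_of_quadratic C0 (ux x).
split; last first.
  by move=> x; apply/rowP => j; rewrite mxE (uD x).2 dot_delta.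
split=> [x|v]; first exact: (uD x).1.
have -> : 'D_v u = fun x => dot (p x) v by apply/funext => x; exact: (uD x).2.
have pL j x e : `|p (x + e) 0 j - p x 0 j| <= 6 * C * enorm e.
  have := enorm_ge0 e; rewrite le_eqVlt => /predU1P[e0|e0].
    have -> : e = 0.
      apply/rowP => k; rewrite mxE; apply/eqP; rewrite -normr_le0 e0.
      exact: normr_coord_le_enorm.
    by rewrite addr0 subrr normr0 mulr_ge0 ?enorm_ge0// mulr_ge0.
  set t := enorm e in e0 *; pose h : 'rV[R]_d := t *: delta_mx 0 j.
  have tt : dot e e = t ^+ 2 by rewrite enorm_sqr.
  have hh : dot h h = t ^+ 2.
    by rewrite /h dotZl dotZr dot_delta mxE !eqxx mulr1 -expr2.
  have php y : dot (p y) h = p y 0 j * t by rewrite /h dotZr dot_delta mulrC.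
  clearbody h.
  have eh : dot (e + h) (e + h) <= 4 * t ^+ 2.
    by have := dot_ge0 (e - h); rewrite !dotE (dotC h e) tt hh; lra.
  have h1 := ux (x + e) h; have h2 := ux x (e + h); have h3 := ux x e.
  rewrite (addrA x e h) in h2.
  have h4 : C * dot (e + h) (e + h) <= C * (4 * t ^+ 2) by rewrite ler_wpM2l.
  rewrite -(ler_pM2r e0) -{1}(gtr0_norm e0) -normrM.
  have -> : (p (x + e) 0 j - p x 0 j) * t = dot (p (x + e)) h - dot (p x) h.
    by rewrite !php; ring.
  move: h1 h2 h3; rewrite !ler_norml hh tt (dotDr e h (p x)) => /andP[a1 a2] /andP[b1 b2] /andP[c1 c2].
  by apply/andP; split; lra.
apply: (@elipschitz_continuous _ _ (6 * C * \sum_j `|v 0 j|)) => x y.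
have -> : dot (p x) v - dot (p y) v = \sum_j (p x 0 j - p y 0 j) * v 0 j.
  by rewrite /dot -sumrB; apply: eq_bigr => j _; rewrite mulrBl.
apply: le_trans (ler_norm_sum _ _ _) _.
rewrite mulr_sumr mulr_suml; apply: ler_sum => j _; rewrite normrM.
rewrite mulrAC ler_wpM2r//; have := pL j y (x - y).
by rewrite (addrC y) subrK.
Qed.

End SecondOrder.

(** * Lasry-Lions regularization *)

Section SupConvolution.
Variables (R : realType) (d : nat) (f : 'rV[R]_d -> R) (K k : R).
Hypotheses (K0 : 0 <= K) (k0 : 0 < k) (fK : elipschitz K f).

Lemma sup_convolution : exists (g : 'rV[R]_d -> R) (Z : 'rV[R]_d -> 'rV[R]_d),
  [/\ forall y z, f z - k * dot (z - y) (z - y) <= g y,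
      forall y, g y = f (Z y) - k * dot (Z y - y) (Z y - y),
      forall y, k * enorm (Z y - y) <= K,
      elipschitz K g &
      forall y, f y <= g y <= f y + K * (K / k)].
Proof.
have /choice[Z ZP] := fun y => sup_conv_attained y K0 k0 fK.
pose g y := f (Z y) - k * dot (Z y - y) (Z y - y).
have gge y z : f z - k * dot (z - y) (z - y) <= g y by have [h _] := ZP y; exact: h.
exists g, Z; split => //.
- by move=> y; have [] := ZP y.
(* Translating the maximizer along with the base point leaves the penalty unchanged. *)
- have h (x y : 'rV[R]_d) : g x - g y <= K * enorm (x - y).
    have := gge y (Z x + (y - x)).
    have -> : Z x + (y - x) - y = Z x - x by rewrite addrA addrAC addrK.
    have := fK (Z x) (Z x + (y - x)); rewrite opprD addNKr opprB.
    by rewrite ler_norml => /andP[_]; rewrite /g; lra.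
  move=> x y; rewrite ler_norml; apply/andP; split; last exact: h.
  have := h y x; rewrite (_ : enorm (y - x) = enorm (x - y)); last by rewrite -enormN opprB.
  by clearbody g; lra.
- move=> y; apply/andP; split.
    by have := gge y y; rewrite subrr dot0l mulr0 subr0.
  have [_ h] := ZP y; have := fK (Z y) y; rewrite ler_norml => /andP[_ h2].
  have h3 : enorm (Z y - y) <= K / k by rewrite ler_pdivlMr// mulrC.
  have h4 : K * enorm (Z y - y) <= K * (K / k) by rewrite ler_wpM2l.
  have : 0 <= k * dot (Z y - y) (Z y - y) by rewrite mulr_ge0 ?dot_ge0// ltW.
  by rewrite /g; lra.
Qed.

Lemma sup_convolution_shift g Z T :
  (forall y z, f z - k * dot (z - y) (z - y) <= g y) ->
  (forall y, g y = f (Z y) - k * dot (Z y - y) (Z y - y)) ->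
  (forall x, f (x + T) = f x) -> forall x : 'rV[R]_d, g (x + T) = g x.
Proof.
move=> gge gE fT x; apply/eqP; rewrite eq_le; apply/andP; split.
  rewrite [leLHS]gE; have := gge x (Z (x + T) - T).
  by rewrite -{1}fT subrK -addrA -opprD [T + x]addrC.
rewrite [leLHS]gE; have := gge (x + T) (Z x + T).
by rewrite fT opprD addrACA subrr addr0.
Qed.

End SupConvolution.

Section LasryLions.
Variables (R : realType) (d : nat).

(** As a supremum of the functions f z - k |z - y|^2 of y, g becomes convex after adding k |y|^2, so
    a subgradient inequality with any quadratic loss holds with loss k. The gain from 2k to k is the
    margin that gives the later inf-convolution its lower expansion. *)
Lemma semiconvex_subgradient (f g : 'rV[R]_d -> R) (Z : 'rV[R]_d -> 'rV[R]_d) (k : R)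
    (z b : 'rV[R]_d) : 0 < k ->
  (forall y z, f z - k * dot (z - y) (z - y) <= g y) ->
  (forall y, g y = f (Z y) - k * dot (Z y - y) (Z y - y)) ->
  (forall e, g z + dot b e - 2 * k * dot e e <= g (z + e)) ->
  forall e, g z + dot b e - k * dot e e <= g (z + e).
Proof.
move=> k0 gge gE gz e.
have ee := dot_ge0 e.
(* Convexity along the segment from z to z + e, tested at z + t e: after division by t only the
   error t k |e|^2 remains. *)
have key t : 0 < t -> t <= 1 -> dot b e - k * dot e e - t * (k * dot e e) <= g (z + e) - g z.
  move=> t0 t1; set y := z + t *: e; have h1 := gE y; set a := Z y - z in h1.
  have ya : Z y - y = a - t *: e by rewrite /y /a opprD addrA.
  have h2 := gge z (Z y); rewrite -/a in h2.
  have h3 := gge (z + e) (Z y); rewrite opprD addrA -/a in h3.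
  have h4 := gz (t *: e); rewrite -/y in h4.
  rewrite h1 ya in h4; clearbody a; move: h2 h3 h4; rewrite !dotE (dotC e a) => h2 h3 h4.
  rewrite -(ler_pM2l t0).
  have h5 : (1 - t) * (f (Z y) - k * dot a a) <= (1 - t) * g z.
    by rewrite ler_wpM2l// subr_ge0.
  have h6 := ler_wpM2l (ltW t0) h3.
  nra.
suff : dot b e - k * dot e e <= g (z + e) - g z by lra.
apply/ler_addgt0Pr => eps eps0.
pose t := Num.min 1 (eps / (k * dot e e + 1)).
have kd : 0 <= k * dot e e by rewrite mulr_ge0// ltW.
have kd1 : 0 < k * dot e e + 1 by rewrite ltr_wpDl.
have t0 : 0 < t by rewrite lt_min ltr01 divr_gt0.
have t1 : t <= 1 by rewrite ge_min lexx.
have t2 : t * (k * dot e e + 1) <= eps.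
  by rewrite -ler_pdivlMr// ge_min lexx orbT.
by have := key t t0 t1; nra.
Qed.

(* u is the inf-convolution with parameter 2k of the sup-convolution g of f
   with parameter k, which makes it C^{1,1}. The last clause replaces a
   gradient of g: pi is a supergradient of f at a point near x, and it bounds
   the difference quotient of u in a prescribed direction. *)
Lemma lasry_lions (f : 'rV[R]_d -> R) (K k : R) : 0 <= K -> 0 < k -> elipschitz K f ->
  exists (u : 'rV[R]_d -> R) (p : 'rV[R]_d -> 'rV[R]_d),
  [/\ forall x, `|u x - f x| <= K * (K / k),
      forall x h, `|u (x + h) - u x - dot (p x) h| <= 2 * k * dot h h,
      forall x, enorm (p x) <= 2 * K,
      forall T, (forall x, f (x + T) = f x) -> forall x, u (x + T) = u x &
      forall x q h, 0 < h -> exists zeta pi : 'rV[R]_d,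
        [/\ enorm (zeta - x) <= 2 * (K / k) + h * enorm q, enorm pi <= 2 * K,
            forall z, f z <= f zeta + dot pi (z - zeta) + k * dot (z - zeta) (z - zeta) &
            u (x + h *: q) - u x <= h * dot pi q + k * h ^+ 2 * dot q q]].
Proof.
move=> K0 k0 fK.
have [g [Z [gge gE Zb gK gb]]] := sup_convolution K0 k0 fK.
have k20 : 0 < 2 * k by rewrite mulr_gt0.
have NgK : elipschitz K (fun x => - g x).
  by move=> x y; have := gK x y; rewrite -normrN opprB addrC opprK.
have [v [W [vge vE Wb vK vb]]] := sup_convolution K0 k20 NgK.
pose u x := - v x.
have ule x z : u x <= g z + 2 * k * dot (z - x) (z - x).
  by rewrite /u; have := vge x z; lra.
have uE x : u x = g (W x) + 2 * k * dot (W x - x) (W x - x).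
  by rewrite /u vE; lra.
(* Envelope formula: this is the x-gradient of the penalty 2k |z - x|^2 at the minimizer z = W x. *)
pose p x : 'rV[R]_d := (- (4 * k)) *: (W x - x).
exists u, p; split.
- move=> x; have /andP[g1 g2] := gb x; have /andP[v1 v2] := vb x.
  have : K * (K / (2 * k)) <= K * (K / k).
    by rewrite ler_wpM2l// ler_wpM2l// lef_pV2 ?posrE//; lra.
  by rewrite ler_norml /u => h; apply/andP; split; lra.
- move=> x h; set a := W x - x; have hp : p x = (- (4 * k)) *: a by [].
  rewrite hp dotZl ler_norml; apply/andP; split; last first.
    have := ule (x + h) (W x); rewrite opprD addrA -/a (uE x) -/a.
    by clearbody a; rewrite !dotE (dotC h a); lra.
  (* Minimality of W x gives g a subgradient there with loss 2k. Once the loss is improved to k, the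
     quadratic terms left are 2k |y - h|^2 - k |y|^2 = k |y - 2h|^2 - 2k |h|^2, bounded below
     whatever the displacement y of the minimizer. *)
  have gw e : g (W x) + dot (- (4 * k) *: a) e - 2 * k * dot e e <= g (W x + e).
    have := ule x (W x + e); rewrite addrAC -/a uE -/a.
    by clearbody a; rewrite !dotE (dotC e a); lra.
  have gs := semiconvex_subgradient k0 gge gE gw.
  set y := W (x + h) - W x; have yE : W (x + h) = W x + y by rewrite /y [RHS]addrC subrK.
  rewrite (uE (x + h)) yE uE -/a.
  have -> : W x + y - (x + h) = a + (y - h) by rewrite /a opprD addrACA.
  clearbody a y; have := gs y; rewrite !dotE (dotC y a) (dotC h a) (dotC h y) => gy.
  have : 0 <= dot (y - 2 *: h) (y - 2 *: h) by exact: dot_ge0.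
  rewrite !dotE (dotC h y) => /(mulr_ge0 (ltW k0)); lra.
- move=> x; rewrite /p enormZ normrN gtr0_norm ?mulr_gt0//.
  by have := Wb x; lra.
- move=> T fT x; congr (- _).
  apply: (sup_convolution_shift vge vE) => y; congr (- _).
  exact: (sup_convolution_shift gge gE).
- move=> x q h h0; set z := W x; set y := z + h *: q; set a := Z y - y.
  have aK : k * enorm a <= K by exact: Zb.
  (* f lies below the paraboloid g y + k |. - y|^2 and meets it at Z y, where its gradient is 2k (Z
     y - y). In the difference of u, moving the minimizer W x together with x cancels the outer
     penalty. *)
  exists (Z y), ((2 * k) *: a); split.
  + have -> : Z y - x = a + (h *: q + (z - x)).
      by rewrite /a /y; apply/rowP => j; rewrite !mxE; ring.
    apply: le_trans (enormD _ _) _; rewrite [leRHS]addrC.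
    have hx := enormD (h *: q) (z - x); rewrite enormZ (gtr0_norm h0) in hx.
    have aK' : enorm a <= K / k by rewrite ler_pdivlMr// mulrC.
    have zx : enorm (z - x) <= K / k.
      rewrite ler_pdivlMr// mulrC; have := Wb x; rewrite -/z.
      by have := enorm_ge0 (z - x); nra.
    lra.
  + by rewrite enormZ gtr0_norm//; lra.
  + move=> w; have := gge y w; rewrite gE -/a.
    have -> : w - y = (w - Z y) + a by rewrite /a addrA subrK.
    move: (w - Z y) => e; clearbody a.
    by rewrite !dotE (dotC e a); lra.
  + have h1 := ule (x + h *: q) y.
    have h2 := uE x; rewrite -/z in h2.
    have e1 : y - (x + h *: q) = z - x by rewrite /y opprD addrACA subrr addr0.
    rewrite e1 in h1.
    have h3 := gge z (Z y); have h4 := gE y; rewrite -/a in h4.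
    have e2 : Z y - z = a + h *: q by rewrite /a /y opprD addrA subrK.
    rewrite e2 in h3; clearbody a; move: h1 h2 h3 h4; rewrite !dotE (dotC q a) => h1 h2 h3 h4.
    by lra.
Qed.

End LasryLions.

(** * Functions on the torus and their periodic lifts *)

Section TorusLift.
Variables (R : realType) (d : nat).
Implicit Types (x y T : 'rV[R]_d).

Lemma tprojP x y : reflect (tproj x = tproj y) (lattice_eq x y).
Proof. exact: eqmodP. Qed.

Lemma tproj_repr (x : torus R d) : tproj (repr x) = x.
Proof. exact: reprK. Qed.

Definition int_row T := forall j, T 0 j \is a Num.int.

Lemma tproj_shift x T : int_row T -> tproj (x + T) = tproj x.
Proof.
by move=> TZ; apply/tprojP/forallP => j; rewrite mxE addrAC subrr add0r.
Qed.

Lemma tproj_eq_shift x y : tproj x = tproj y -> exists2 T, int_row T & x = y + T.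
Proof.
move/tprojP/forallP => xy; exists (x - y); last by rewrite addrC subrK.
by move=> j; rewrite !mxE.
Qed.

Lemma unit_cube_shift x : exists2 T, int_row T & forall j, 0 <= (x + T) 0 j <= 1.
Proof.
exists (\row_j (- (Num.floor (x 0 j))%:~R)) => j; rewrite !mxE ?rpredN ?intr_int//.
have := floor_le (x 0 j); have := floorD1_gt (x 0 j); rewrite intrD => h1 h2.
by apply/andP; split; lra.
Qed.

Lemma centered_shift x : exists2 T, int_row T & forall j, `|(x + T) 0 j| <= 2^-1.
Proof.
have [T TZ hT] := unit_cube_shift (x + const_mx 2^-1); exists T => // j.
by have := hT j; rewrite !mxE ler_norml => /andP[a b]; apply/andP; split; lra.
Qed.

Definition lattice_periodic (u : 'rV[R]_d -> R) :=
  forall T, int_row T -> forall x, u (x + T) = u x.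

Lemma lift_periodic (f : torus R d -> R) : lattice_periodic (f \o @tproj R d).
Proof. by move=> T TZ x /=; rewrite tproj_shift. Qed.

Lemma descendK (u : 'rV[R]_d -> R) : lattice_periodic u ->
  (fun x : torus R d => u (repr x)) \o @tproj R d = u.
Proof.
move=> uT; apply/funext => x /=.
by have [T TZ ->] := tproj_eq_shift (tproj_repr (tproj x)); rewrite uT.
Qed.

Lemma grad_shift (u : 'rV[R]_d -> R) T x : (forall x, u (x + T) = u x) ->
  grad u (x + T) = grad u x.
Proof.
move=> uT; apply/rowP => j; rewrite !mxE /derive.
set v := delta_mx _ _.
have -> : (fun h : R => h^-1 *: ((u \o shift (x + T)) (h *: v) - u (x + T))) =
    fun h => h^-1 *: ((u \o shift x) (h *: v) - u x).
  by apply/funext => h /=; rewrite addrA !uT.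
by [].
Qed.

Lemma tgrad_tproj (f : torus R d -> R) x : tgrad f (tproj x) = grad (f \o @tproj R d) x.
Proof.
rewrite /tgrad; have [T TZ ->] := tproj_eq_shift (tproj_repr (tproj x)).
by apply: grad_shift => y; exact: lift_periodic.
Qed.

Lemma tproj_continuous : continuous (@tproj R d).
Proof. exact: pi_continuous. Qed.

Lemma torus_continuousP (T : topologicalType) (f : torus R d -> T) :
  continuous (f \o @tproj R d) -> continuous f.
Proof.
move=> /continuousP cf; apply/continuousP => U oU.
exact: cf.
Qed.

Lemma tdist_le x y : tdist (tproj x) (tproj y) <= enorm (x - y).
Proof.
apply: ge_inf; last by exists x, y.
by exists 0 => _ [a [b [_ _ ->]]]; exact: enorm_ge0.
Qed.

Lemma tdist_ge0 (x y : torus R d) : 0 <= tdist x y.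
Proof.
apply: lb_le_inf; last by move=> _ [a [b [_ _ ->]]]; exact: enorm_ge0.
by exists (enorm (repr x - repr y)), (repr x), (repr y); rewrite !tproj_repr.
Qed.

Lemma torus_lipschitz_lift n (v : torus R d -> 'I_n.+1 -> R) : torus_lipschitz v ->
  exists2 K, 0 <= K & forall i, elipschitz K ((v ^~ i) \o @tproj R d).
Proof.
move=> [K vK]; exists `|K| => // i x y /=; apply: le_trans (vK i _ _) _.
have := ler_norm K; have := normr_ge0 K; have := tdist_le x y.
have := tdist_ge0 (tproj x) (tproj y); nra.
Qed.

(** Periodic bumps centred at z, one per coordinate, replace the paraboloid. They dominate it only
    within half a period of z, so each y is first moved there by a lattice vector, which changes
    neither f nor the bumps. *)
Lemma torus_quadratic_test (f : torus R d -> R) (z p : 'rV[R]_d) (k : R) : 0 <= k ->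
  (forall y : 'rV[R]_d, f (tproj y) <= f (tproj z) + dot p (y - z) + k * dot (y - z) (y - z)) ->
  exists phi : torus R d -> R, [/\ torus_C1 phi, tgrad phi (tproj z) = p &
    forall y : torus R d, f y - phi y <= f (tproj z) - phi (tproj z)].
Proof.
move=> k0 fz.
have /choice[psi /choice[dpsi /choice[C B]]] := fun j => periodic_quadratic_bump (p 0 j) k0.
pose u (y : 'rV[R]_d) := \sum_(j < d) psi j (y 0 j - z 0 j).
pose g (y : 'rV[R]_d) : 'rV[R]_d := \row_j dpsi j (y 0 j - z 0 j).
have up : lattice_periodic u.
  move=> T TZ y; apply: eq_bigr => j _; have [_ _ per _] := B j.
  have /intrP[m Tm] := TZ j; rewrite mxE Tm addrAC; exact: per.
have C0 : 0 <= \sum_j C j by apply: sumr_ge0 => j _; have [_ [Cj _] _ _] := B j.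
have uq y h : `|u (y + h) - u y - dot (g y) h| <= (\sum_j C j) * dot h h.
  rewrite /u /dot -!sumrB mulr_suml; apply: le_trans (ler_norm_sum _ _ _) _.
  apply: ler_sum => j _; have [_ [Cj hj] _ _] := B j.
  have -> : (y + h) 0 j - z 0 j = (y 0 j - z 0 j) + h 0 j by rewrite mxE addrAC.
  rewrite mxE; apply: le_trans (hj _ _) _.
  by rewrite ler_wpM2l//; exact: sqr_coord_le_dot.
have [uC1 ug] := quadratic_C1 C0 uq.
pose phi (y : torus R d) := u (repr y).
have phiE : phi \o @tproj R d = u by exact: descendK.
have phiP y : phi (tproj y) = u y by rewrite -phiE.
have uz : u z = 0.
  by rewrite /u big1// => j _; rewrite subrr; have [[]] := B j.
exists phi; split.
- by rewrite /torus_C1 phiE.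
- rewrite tgrad_tproj phiE ug; apply/rowP => j; rewrite mxE subrr.
  by have [[_ ->]] := B j.
- move=> y; rewrite -(tproj_repr y); move: (repr y) => {}y.
  have [T TZ Ty] := centered_shift (y - z).
  rewrite !phiP -(tproj_shift y TZ) -(up T TZ y) uz subr0 lerBlDr.
  apply: le_trans (fz _) _; rewrite -addrA lerD2l.
  rewrite /u /dot mulr_sumr -big_split/=; apply: ler_sum => j _.
  have [_ _ _ hj] := B j; have := Ty j; rewrite !mxE => Tyj.
  have := hj (y 0 j + T 0 j - z 0 j); rewrite addrAC => /(_ Tyj).
  by rewrite expr2.
Qed.

End TorusLift.

(** * Gradients, mean values and tangents of convex functions *)

Section Calculus.
Variables (R : realType) (d : nat).

Lemma row_basis (v : 'rV[R]_d) : v = \sum_j v 0 j *: delta_mx 0 j.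
Proof. exact: row_sum_delta. Qed.

Lemma derive_dot_grad (F : 'rV[R]_d -> R) x v : differentiable F x ->
  'D_v F x = dot (grad F x) v.
Proof.
move=> dF; rewrite deriveE// {1}(row_basis v) raddf_sum /dot/=.
apply: eq_bigr => j _; rewrite linearZ/= mxE deriveE// /GRing.scale/=.
by rewrite mulrC.
Qed.

Lemma mean_value_lipschitz (F : 'rV[R]_d -> R) M : 
  (forall x, differentiable F x) -> (forall x, enorm (grad F x) <= M) ->
  forall x e, `|F (x + e) - F x| <= M * enorm e.
Proof.
move=> dF gF x e.
pose l (t : R) : 'rV[R]_d := x + t *: e.
have dphi (t : R) : is_derive t 1 (F \o l) (dot (grad F (l t)) e).
  have E : (fun h : R => h^-1 *: (((F \o l) \o shift t) (h *: (1 : R)) - (F \o l) t)) =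
      fun h => h^-1 *: ((F \o shift (l t)) (h *: e) - F (l t)).
    apply/funext => h /=; congr (_ *: (F _ - _)).
    by rewrite /l scalerDl addrCA [h *: 1]mulr1.
  have dv := @diff_derivable _ _ _ F (l t) e (dF (l t)).
  split; first by rewrite /derivable E.
  by rewrite /derive E -derive_dot_grad.
have [|c _] := @MVT_segment R (F \o l) (fun t : R => dot (grad F (l t)) e) 0 1 ler01
  (fun t _ => dphi t).
  apply: continuous_subspaceT => t.
  exact/differentiable_continuous/derivable1_diffP.
rewrite /= /l scale1r scale0r addr0 subr0 mulr1 => ->.
apply: le_trans (normr_dot_le _ _) _; rewrite ler_wpM2r ?enorm_ge0//.
Qed.

Lemma convex_above_tangent (F : 'rV[R]_d -> R) p q :
  @convex_function R 'rV[R]_d setT F -> differentiable F p ->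
  F p + dot (grad F p) (q - p) <= F q.
Proof.
move=> cF dF; rewrite -derive_dot_grad//.
have dv := @diff_derivable _ _ _ F p (q - p) dF.
rewrite -lerBrDl /derive cvg_at_rightE//.
have cr : cvg ((fun h => h^-1 *: ((F \o shift p) (h *: (q - p)) - F p)) @ (0 : R)^'+).
  apply/cvg_ex; exists ('D_(q - p) F p); exact: cvg_dnbhs_at_right.
apply: limr_le => //; near=> h.
have h0 : 0 < h by near: h; exact: nbhs_right_gt.
have h1 : h <= 1 by near: h; exact: nbhs_right_le.
rewrite /= [_ *: _]mulrC ler_pdivrMr//.
have := cF (Itv01 (ltW h0) h1) q p (in_setT _) (in_setT _).
have -> : conv (Itv01 (ltW h0) h1) (q : convex_lmodType 'rV[R]_d) (p : convex_lmodType 'rV[R]_d) = h *: (q - p) + p.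
  transitivity (h *: q + (1 - h) *: p); first by [].
  by apply/rowP => j; rewrite !mxE; ring.
by rewrite convRE /= /unstable.onem; lra.
Unshelve. all: by end_near. Qed.

End Calculus.

(** * Smooth approximate subsolutions *)

Section Momentum.
Variables (R : realType) (d n : nat).
Local Notation V := 'rV[R]_d.
Variable H : torus R d -> V -> 'I_n.+1 -> R.
Hypothesis H_C2 : forall i, @is_C2 R (V * V)%type (fun z => H (tproj z.1) z.2 i).
Hypothesis A1 : forall x i, @convex_function R V setT (fun p => H x p i).

Definition DpH (x : torus R d) (p : V) (i : 'I_n.+1) : V := grad (fun p => H x p i) p.

Lemma hamiltonian_differentiable i (z : V * V) :
  differentiable (fun z : V * V => H (tproj z.1) z.2 i) z.
Proof. by have [[dH _] _] := H_C2 i. Qed.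

Lemma hamiltonian_continuous i : continuous (fun z : V * V => H (tproj z.1) z.2 i).
Proof. by move=> z; apply: differentiable_continuous; exact: hamiltonian_differentiable. Qed.

Lemma hamiltonian_diff_p x p i : differentiable (fun p => H (tproj x) p i) p.
Proof.
pose l (p : V) := (x, p) : V * V.
rewrite (_ : (fun p => _) = (fun z : V * V => H (tproj z.1) z.2 i) \o l)//.
apply: differentiable_comp; last exact: hamiltonian_differentiable.
by apply: differentiable_pair.
Qed.

Lemma hamiltonian_diff_x x p i : differentiable (fun x => H (tproj x) p i) x.
Proof.
pose l (x : V) := (x, p) : V * V.
rewrite (_ : (fun x => _) = (fun z : V * V => H (tproj z.1) z.2 i) \o l)//.
apply: differentiable_comp; last exact: hamiltonian_differentiable.
by apply: differentiable_pair.
Qed.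

(** As a directional derivative on the product space, each component inherits joint continuity in
    (x, p) from the regularity of H. *)
Lemma DpH_coord x p i j : DpH (tproj x) p i 0 j =
  'D_((0 : V, delta_mx 0 j : V)) (fun z : V * V => H (tproj z.1) z.2 i) (x, p).
Proof.
rewrite mxE /derive; set v := delta_mx _ _.
have -> : (fun h : R => h^-1 *: (((fun z : V * V => H (tproj z.1) z.2 i) \o shift (x, p))
      (h *: (0 : V, v : V)) - H (tproj (x, p).1) (x, p).2 i)) =
    fun h => h^-1 *: (((fun p => H (tproj x) p i) \o shift p) (h *: v) - H (tproj x) p i).
  by apply/funext => h /=; rewrite scaler0 add0r.
by [].
Qed.

Lemma row_continuous (T : topologicalType) (f : T -> V) :
  (forall j, continuous (fun x => f x 0 j)) -> continuous f.
Proof.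
move=> cf x.
have -> : f = fun x => \sum_j f x 0 j *: (delta_mx 0 j : V).
  by apply/funext => y; exact: row_basis.
apply: cvg_big; first exact: add_continuous.
by move=> j _; apply: cvgZl; exact: cf.
Qed.

Lemma DpH_continuous i : continuous (fun z : V * V => DpH (tproj z.1) z.2 i).
Proof.
apply: row_continuous => j.
have -> : (fun z : V * V => DpH (tproj z.1) z.2 i 0 j) =
    'D_((0 : V, delta_mx 0 j : V)) (fun z : V * V => H (tproj z.1) z.2 i).
  by apply/funext => -[x p]; rewrite DpH_coord.
by have [[_ cH] _] := H_C2 i; exact: cH.
Qed.

Lemma hamiltonian_tangent x p q i : H x p i + dot (DpH x p i) (q - p) <= H x q i.
Proof.
rewrite -(tproj_repr x); apply: convex_above_tangent; first exact: A1.
exact: hamiltonian_diff_p.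
Qed.

Lemma hamiltonian_lipschitz_x C P x e p i : 
  (forall x p i, enorm (DxH H x p i) <= C * (1 + enorm p ^+ 2)) ->
  0 <= C -> enorm p <= P ->
  `|H (tproj (x + e)) p i - H (tproj x) p i| <= C * (1 + P ^+ 2) * enorm e.
Proof.
move=> A3 C0 pP.
apply: (@mean_value_lipschitz R d (fun x => H (tproj x) p i)).
  by move=> y; exact: hamiltonian_diff_x.
move=> y; have := A3 (tproj y) p i; rewrite /DxH tgrad_tproj => /le_trans; apply.
rewrite ler_wpM2l// lerD2l ler_sqr ?nnegrE ?enorm_ge0//.
exact: (le_trans (enorm_ge0 p) pP).
Qed.

End Momentum.

(** * Estimates on the coupling term *)

Section Coupling.
Variables (R : realType) (d n : nat) (c : 'I_n.+1 -> 'I_n.+1 -> R).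
Hypothesis c_ge0 : forall i j, 0 <= c i j.

Definition coupling := \sum_i \sum_j c i j.

Lemma coupling_ge0 : 0 <= coupling.
Proof. by apply: sumr_ge0 => i _; apply: sumr_ge0. Qed.

Lemma Theta_close (phi psi : torus R d -> 'I_n.+1 -> R) x y i (delta : R) :
  (forall j, `|phi x j - psi y j| <= delta) ->
  `|Theta c phi x i - Theta c psi y i| <= 2 * coupling * delta.
Proof.
move=> h; have d0 : 0 <= delta by exact: le_trans (h i).
rewrite /Theta -sumrB; apply: le_trans (ler_norm_sum _ _ _) _.
apply: (@le_trans _ _ (\sum_j c i j * (2 * delta))).
  apply: ler_sum => j _; rewrite -mulrBr normrM ger0_norm// ler_wpM2l//.
  rewrite (_ : _ - _ = (phi x i - psi y i) - (phi x j - psi y j)); last ring.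
  by apply: le_trans (ler_normB _ _) _; have := h i; have := h j; lra.
rewrite -mulr_suml (mulrC 2 (coupling)) -mulrA ler_wpM2r ?mulr_ge0//.
rewrite /coupling [leRHS](bigD1 i)//= lerDl; apply: sumr_ge0 => k _; exact: sumr_ge0.
Qed.

(** Quasi-monotonicity of the system: maximizing over the index as well as over x allows the
    coupling of a supersolution to be replaced by that of its test function. *)
Lemma ThetaB_max (phi psi : torus R d -> 'I_n.+1 -> R) x i :
  (forall j, phi x j - psi x j <= phi x i - psi x i) ->
  Theta c psi x i <= Theta c phi x i.
Proof.
by move=> h; apply: ler_sum => j _; rewrite ler_wpM2l//; have := h j; lra.
Qed.

End Coupling.

Section SmoothSubsolution.
Variables (R : realType) (d n : nat).
Local Notation V := 'rV[R]_d.
Variable H : torus R d -> V -> 'I_n.+1 -> R.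
Hypothesis H_C2 : forall i, @is_C2 R (V * V)%type (fun z => H (tproj z.1) z.2 i).
Hypothesis A1 : forall x i, @convex_function R V setT (fun p => H x p i).
Variable C : R.
Hypotheses (C0 : 0 <= C) (A3 : forall x p i, enorm (DxH H x p i) <= C * (1 + enorm p ^+ 2)).
Variable c : 'I_n.+1 -> 'I_n.+1 -> R.
Hypothesis c_ge0 : forall i j, 0 <= c i j.

Lemma subsolution_supergradient (v : torus R d -> 'I_n.+1 -> R) i (z p : V) k :
  viscosity_subsolution H c v -> 0 <= k ->
  (forall y, v (tproj y) i <= v (tproj z) i + dot p (y - z) + k * dot (y - z) (y - z)) ->
  H (tproj z) p i + Theta c v (tproj z) i <= 0.
Proof.
move=> [_ vsub] k0 vz.
have [phi [C1phi <- phimax]] := @torus_quadratic_test R d (v ^~ i) z p k k0 vz.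
exact: vsub.
Qed.

Lemma le_of_linear_error (a b e : R) :
  (forall h, 0 < h -> h <= 1 -> a <= b + h * e) -> a <= b.
Proof.
move=> h; apply/ler_addgt0Pr => eps eps0.
pose t := Num.min 1 (eps / (`|e| + 1)).
have e1 : 0 < `|e| + 1 by rewrite ltr_wpDl.
have t0 : 0 < t by rewrite lt_min ltr01 divr_gt0.
have t1 : t <= 1 by rewrite ge_min lexx.
have t2 : t * (`|e| + 1) <= eps by rewrite -ler_pdivlMr// ge_min lexx orbT.
apply: le_trans (h t t0 t1) _; have := ler_norm e; nra.
Qed.

(* With q = DpH(x, Dw(x)), the difference quotient of w in the direction q and
   the subsolution test at the supergradient pi near x give, up to small terms,
   q . Dw <= q . pi and H(x, pi) + Theta v <= 0; the tangent inequality
   H(Dw) + q . (pi - Dw) <= H(pi) then bounds H(x, Dw). *)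
Lemma smooth_subsolution (v : torus R d -> 'I_n.+1 -> R) (K s : R) :
  viscosity_subsolution H c v -> 0 <= K ->
  (forall i, elipschitz K ((v ^~ i) \o @tproj R d)) -> 0 < s ->
  exists w : torus R d -> 'I_n.+1 -> R,
    [/\ forall i, torus_C1 (w ^~ i), forall x i, `|w x i - v x i| <= s,
        forall x i, enorm (tgrad (w ^~ i) x) <= 2 * K &
        forall x i, H x (tgrad (w ^~ i) x) i + Theta c w x i <= s].
Proof.
move=> vsub K0 vK s0.
pose MH := C * (1 + (2 * K) ^+ 2).
have MH0 : 0 <= MH by rewrite mulr_ge0// addr_ge0// sqr_ge0.
have G0 := coupling_ge0 c_ge0; pose G := coupling c; rewrite -/G in G0.
(* B collects what multiplies kap = K / k below. Up to a term in h, zeta is within 2 kap of x;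
   moving H and Theta v over that distance costs MH + 2 G K per unit length, and passing from Theta
   v to Theta w costs 2 G K. The summand K keeps w within s of v. *)
pose B := 2 * (MH + 2 * G * K) + 2 * G * K + K + 1.
have GK : 0 <= G * K by rewrite mulr_ge0.
have B0 : 0 < B by rewrite /B; lra.
have K1 : 0 < K + 1 by lra.
(* The factor K + 1 keeps k positive even for K = 0. *)
pose k := (K + 1) * B / s.
have k0 : 0 < k by rewrite /k divr_gt0// mulr_gt0.
pose kap := K / k.
have kap0 : 0 <= kap by rewrite divr_ge0// ltW.
have kapB : kap * B <= s.
  rewrite /kap mulrAC ler_pdivrMr// (_ : s * k = (K + 1) * B).
    by rewrite ler_wpM2r ?ltW// ltrDl.
  by rewrite /k mulrC divfK// gt_eqF.
have /choice[u /choice[p up]] := fun i => lasry_lions K0 k0 (vK i).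
have uper i : lattice_periodic (u i).
  move=> T TZ; have [_ _ _ + _] := up i; apply => y.
  exact: (lift_periodic (v ^~ i) TZ).
pose w (x : torus R d) i := u i (repr x).
have wE i : (w ^~ i) \o @tproj R d = u i by exact: (descendK (uper i)).
have wu i x : w (tproj x) i = u i x by rewrite -wE.
have k20 : 0 <= 2 * k by lra.
have uC1 i : is_C1 (u i) /\ forall x, grad (u i) x = p i x.
  by have [_ uq _ _ _] := up i; exact: quadratic_C1 uq.
have gw i x : tgrad (w ^~ i) (tproj x) = p i x.
  by rewrite tgrad_tproj wE (uC1 i).2.
have wv x i : `|w (tproj x) i - v (tproj x) i| <= K * kap.
  by rewrite wu; have [uf _ _ _ _] := up i; exact: uf.
have kaps : K * kap <= s by apply: le_trans kapB; rewrite /B; nra.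
exists w; split.
- by move=> i; rewrite /torus_C1 wE; have [] := uC1 i.
- by move=> x i; rewrite -(tproj_repr x); exact: le_trans (wv _ _) _.
- by move=> x i; rewrite -(tproj_repr x) gw; have [_ _ + _ _] := up i; exact.
move=> x' i; rewrite -(tproj_repr x') gw; move: (repr x') => x.
pose q := DpH H (tproj x) (p i x) i.
have hTw : Theta c w (tproj x) i <= Theta c v (tproj x) i + 2 * G * (K * kap).
  have := @Theta_close R d n c c_ge0 w v (tproj x) (tproj x) i (K * kap) (fun j => wv x j).
  by rewrite ler_norml => /andP[_]; rewrite -/G; lra.
(* k stays fixed while h tends to 0, so the large coefficient 3 k is harmless; 2 k of it comes from
   the expansion of u and k from its difference quotient. *)
have key h : 0 < h -> h <= 1 ->
    H (tproj x) (p i x) i + Theta c v (tproj x) i <=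
    (MH + 2 * G * K) * (2 * kap) + h * ((MH + 2 * G * K) * enorm q + 3 * k * dot q q).
  move=> h0 h1; have [_ uq _ _ usup] := up i.
  have [zeta [pi [zx piK vz udiff]]] := usup x q h h0.
  have h2 := subsolution_supergradient vsub (ltW k0) vz.
  have h3 := @hamiltonian_lipschitz_x R d n H H_C2 C (2 * K) x (zeta - x) pi i A3 C0 piK.
  rewrite -/MH (addrC x) subrK in h3.
  have h4 := hamiltonian_tangent H_C2 A1 (tproj x) (p i x) pi i; rewrite -/q in h4.
  have h5 := uq x (h *: q).
  have h6 := @Theta_close R d n c c_ge0 v v (tproj zeta) (tproj x) i (K * enorm (zeta - x))
    (fun j => vK j zeta x).
  rewrite -/G in h6.
  have zx0 := enorm_ge0 (zeta - x).
  have h7 : MH * enorm (zeta - x) <= MH * (2 * kap + h * enorm q) by rewrite ler_wpM2l.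
  have h8 : G * K * enorm (zeta - x) <= G * K * (2 * kap + h * enorm q) by rewrite ler_wpM2l.
  move: h3 h5 h6; rewrite !ler_norml => /andP[h3 _] /andP[h5 _] /andP[h6 _].
  rewrite !dotE in h4 h5; rewrite -(ler_pM2l h0).
  have h9 : h * dot pi q <= h * (dot q (p i x) - H (tproj x) (p i x) i - Theta c v (tproj x) i
     + (MH + 2 * G * K) * (2 * kap + h * enorm q)).
    by rewrite ler_wpM2l ?(ltW h0)// (dotC pi); lra.
  rewrite (dotC _ q) in h5; lra.
have := le_of_linear_error key.
move: kapB; rewrite /B => kapB kk.
have : 0 <= kap * (K + 1) by rewrite mulr_ge0// ltW.
lra.
Qed.

End SmoothSubsolution.

(** * The Riesz-Markov theorem *)

Section RegularCompact.
Variables (Y : ptopologicalType).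
Hypothesis Yreg : regular_space Y.

Lemma compact_open_closed_between (C U : set Y) : compact C -> open U -> C `<=` U ->
  exists W V : set Y, [/\ open W, closed V, C `<=` W, W `<=` V & V `<=` U].
Proof.
move=> cC oU CU.
have h x : exists W : set Y, C x -> [/\ open W, W x & closure W `<=` U].
  have [Cx|nCx] := pselect (C x); last by exists set0.
  have nU : nbhs x U by apply: open_nbhs_nbhs; split => //; exact: CU.
  have [A nA AU] := Yreg nU.
  exists A^° => _; split; [exact: open_interior|exact: nA|].
  exact: subset_trans (closure_subset (@interior_subset _ A)) AU.
have /choice[N NP] := h.
have := cC; rewrite compact_cover => /(_ Y C N)[x Cx||D DC CD].
- by have [] := NP x Cx.
- by move=> x Cx; exists x => //; have [] := NP x Cx.
exists (\bigcup_(i in [set` D]) N i), (\bigcup_(i in [set` D]) closure (N i)).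
split => //.
- by apply: bigcup_open => i Di; have [] := NP i (set_mem (DC _ Di)).
- by apply: closed_bigcup => // i _; exact: closed_closure.
- by move=> x [i Di Ox]; exists i => //; exact: subset_closure.
- by move=> x [i Di Ox]; have [_ _] := NP i (set_mem (DC _ Di)); exact.
Qed.

(** C minus U is a compact subset of V, so it has an open neighbourhood W inside a closed F inside
    V; then C minus W and C meet F are the two pieces. *)
Lemma compact_split (C U V : set Y) : compact C -> open U -> open V -> C `<=` U `|` V ->
  exists C1 C2, [/\ compact C1, compact C2, C1 `<=` U, C2 `<=` V & C `<=` C1 `|` C2].
Proof.
move=> cC oU oV CUV.
have cCU : compact (C `&` ~` U).
  by apply: compact_closedI => //; exact: open_closedC.
have [|W [F [oW cF CW WF FV]]] := compact_open_closed_between cCU oV.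
  by move=> x [/CUV[]].
exists (C `&` ~` W), (C `&` F); split.
- by apply: compact_closedI => //; exact: open_closedC.
- exact: compact_closedI.
- by move=> x [Cx nW]; apply: contrapT => nU; apply: nW; exact: CW.
- by move=> x [_ /FV].
- move=> x Cx; have [Wx|nWx] := pselect (W x); last by left.
  by right; split => //; exact: WF.
Qed.

End RegularCompact.

(** * From a finitely additive set function to a regular Borel measure *)

Section Content.
Variables (R : realType) (Y : ptopologicalType) (m : set Y -> R).
Hypotheses (Yreg : regular_space Y) (Yhaus : hausdorff_space Y).
Hypothesis m_ge0 : forall A, 0 <= m A.
Hypothesis m0 : m set0 = 0.
Hypothesis m_le : forall A B, A `<=` B -> m A <= m B.
Hypothesis m_setU_le : forall A B, m (A `|` B) <= m A + m B.
Hypothesis m_disjoint : forall A B, A `&` B = set0 -> m A + m B <= m (A `|` B).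

(** Finite additivity of m carries no regularity, so its values on open sets are replaced by suprema
    over compact subsets. In general only the inequality [inner_content_le_m] links the two. *)
Definition inner_content (U : set Y) : \bar R :=
  ereal_sup [set (m C)%:E | C in [set C | compact C /\ C `<=` U]].

Definition outer_content (A : set Y) : \bar R :=
  ereal_inf [set inner_content U | U in [set U | open U /\ A `<=` U]].

Local Open Scope ereal_scope.

Lemma inner_content_ge C U : compact C -> C `<=` U -> (m C)%:E <= inner_content U.
Proof. by move=> cC CU; apply: ereal_sup_ubound; exists C. Qed.

Lemma inner_content_le_m U : inner_content U <= (m U)%:E.
Proof. by apply: ge_ereal_sup => _ [C [_ CU] <-]; rewrite lee_fin m_le. Qed.

Lemma inner_content_ge0 U : 0 <= inner_content U.
Proof. by rewrite -[0]/(0%R%:E) -m0; apply: inner_content_ge; [exact: compact0|]. Qed.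

Lemma le_inner_content U V : U `<=` V -> inner_content U <= inner_content V.
Proof.
move=> UV; apply: ge_ereal_sup => _ [C [cC CU] <-].
by apply: inner_content_ge => //; exact: subset_trans UV.
Qed.

Lemma outer_content_le A U : open U -> A `<=` U -> outer_content A <= inner_content U.
Proof. by move=> oU AU; apply: ereal_inf_lbound; exists U. Qed.

Lemma outer_content_open U : open U -> outer_content U = inner_content U.
Proof.
move=> oU; apply/eqP; rewrite eq_le outer_content_le//=.
by apply: le_ereal_inf_tmp => _ [V [oV UV] <-]; exact: le_inner_content.
Qed.

Lemma outer_content_ge0 A : 0 <= outer_content A.
Proof. by apply: le_ereal_inf_tmp => _ [V _ <-]; exact: inner_content_ge0. Qed.

Lemma outer_content0 : outer_content set0 = 0.
Proof.
apply/eqP; rewrite eq_le outer_content_ge0 andbT.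
apply: le_trans (outer_content_le open0 _) _ => //.
by apply: le_trans (inner_content_le_m _) _; rewrite m0.
Qed.

Lemma le_outer_content : {homo outer_content : A B / A `<=` B >-> A <= B}.
Proof.
move=> A B AB; apply: le_ereal_inf_tmp => _ [V [oV BV] <-].
by apply: outer_content_le => //; exact: subset_trans BV.
Qed.

Lemma outer_content_fin A : outer_content A \is a fin_num.
Proof.
rewrite ge0_fin_numE ?outer_content_ge0//.
apply: le_lt_trans (outer_content_le openT _) _ => //.
by apply: le_lt_trans (inner_content_le_m _) _; rewrite ltry.
Qed.

Lemma inner_contentU U V : open U -> open V ->
  inner_content (U `|` V) <= inner_content U + inner_content V.
Proof.
move=> oU oV; apply: ge_ereal_sup => _ [C [cC CUV] <-].
have [C1 [C2 [c1 c2 CU CV CC]]] := compact_split Yreg cC oU oV CUV.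
apply: (@le_trans _ _ ((m C1)%:E + (m C2)%:E)).
  by rewrite -EFinD lee_fin; apply: le_trans (m_setU_le _ _); exact: m_le.
by apply: leeD; exact: inner_content_ge.
Qed.

Lemma inner_content_bigcup_ord (U : (set Y)^nat) n : (forall i, open (U i)) ->
  inner_content (\bigcup_(i in `I_n) U i) <= \sum_(0 <= i < n) inner_content (U i).
Proof.
move=> oU; elim: n => [|n IH].
  rewrite big_nil II0 bigcup_set0.
  by apply: le_trans (inner_content_le_m _) _; rewrite m0.
rewrite IIS bigcup_setU bigcup_set1 big_nat_recr//=.
by apply: le_trans (inner_contentU _ _) _ => //; [exact: bigcup_open|exact: leeD].
Qed.

(** A compact subset of the union lies in finitely many of the sets; this is how a finitely additive
    m yields countable subadditivity. *)
Lemma inner_content_bigcup (U : (set Y)^nat) : (forall i, open (U i)) ->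
  inner_content (\bigcup_i U i) <= \sum_(i <oo) inner_content (U i).
Proof.
move=> oU; apply: ge_ereal_sup => _ [C [cC CU] <-].
move: (cC); rewrite compact_cover => /(_ nat setT U)[//|//|D _ CD].
pose n := (\max_(i <- D) i).+1.
apply: (@le_trans _ _ (\sum_(0 <= i < n) inner_content (U i))).
  apply: le_trans (inner_content_bigcup_ord n oU); apply: inner_content_ge => //.
  move=> x /CD[i /= Di Ux]; exists i => //=.
  by rewrite /n ltnS; apply: (@leq_bigmax_seq _ _ _ id).
by apply: nneseries_lim_ge => i _ _; exact: inner_content_ge0.
Qed.

Lemma outer_content_sigma_subadditive : sigma_subadditive outer_content.
Proof.
move=> F; apply/lee_addgt0Pr => e e0.
apply: le_trans (epsilon_trick xpredT (fun n => outer_content_ge0 (F n)) (ltW e0)).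
have h n : exists U : set Y, [/\ open U, F n `<=` U &
    inner_content U <= outer_content (F n) + (e / (2 ^ n.+1)%:R)%:E].
  have en : (0 < e / (2 ^ n.+1)%:R)%R by rewrite divr_gt0// ltr0n expn_gt0.
  have [_ [U [oU FU] <-] lt] := lb_ereal_inf_adherent en (outer_content_fin (F n)).
  by exists U; split => //; exact: ltW.
have /choice[U UP] := h.
have oU i : open (U i) by have [] := UP i.
apply: le_trans (@outer_content_le _ (\bigcup_i U i) _ _) _.
- exact: bigcup_open.
- by move=> x [i _ Fx]; exists i => //; have [_ + _] := UP i; exact.
apply: le_trans (inner_content_bigcup oU) _.
by apply: lee_nneseries => [i _ _|i _]; [exact: inner_content_ge0|have [] := UP i].
Qed.

HB.instance Definition _ := isOuterMeasure.Build R Y outer_content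
  outer_content0 outer_content_ge0 le_outer_content outer_content_sigma_subadditive.

(** Compact sets are chosen in succession: C inside V meet U, then D inside V minus C. They are
    disjoint, so m C + m D is at most the content of V, while A minus U is covered by V minus C,
    open because compact sets are closed here. *)
Lemma open_caratheodory U : open U -> caratheodory_measurable outer_content U.
Proof.
move=> oU; apply: le_caratheodory_measurable => A.
apply: le_ereal_inf_tmp => _ [V [oV AV] <-].
apply: (@le_trans _ _ (inner_content (V `&` U) + outer_content (A `&` ~` U))).
  rewrite leeD2r// outer_content_le//; first exact: openI.
  by move=> x [Ax Ux]; split => //; exact: AV.
rewrite -leeBrDr ?outer_content_fin//; apply: ge_ereal_sup => _ [C [cC CVU] <-].
rewrite leeBrDr ?outer_content_fin//.
have cl := compact_closed Yhaus cC.
apply: (@le_trans _ _ ((m C)%:E + inner_content (V `&` ~` C))).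
  rewrite leeD2l// outer_content_le//; first by apply: openI => //; exact: closed_openC.
  by move=> x [Ax nU]; split; [exact: AV|move=> /CVU[]].
rewrite addeC -leeBrDr//; apply: ge_ereal_sup => _ [D [cD DVC] <-].
rewrite leeBrDr// -EFinD addrC.
apply: (@le_trans _ _ (m (C `|` D))%:E).
  rewrite lee_fin m_disjoint//; apply/seteqP; split => // x [Cx /DVC[_]]; exact.
by apply: inner_content_ge; [exact: compactU|move=> x [/CVU[]|/DVC[]]].
Qed.

Local Notation B := (borelType Y).

Lemma borel_caratheodory (A : set B) : measurable A ->
  caratheodory_measurable outer_content A.
Proof.
move: A; apply: smallest_sub; last by move=> A; exact: open_caratheodory.
split => //.
- exact: caratheodory_measurable_set0.
- by move=> X mX; rewrite setTD; exact: caratheodory_measurable_setC.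
- by move=> u_ mu_; exact: caratheodory_measurable_bigcup.
Qed.

Definition content_measure (A : set B) : \bar R := outer_content A.

Lemma content_measure0 : content_measure set0 = 0. Proof. exact: outer_content0. Qed.

Lemma content_measure_ge0 A : 0 <= content_measure A.
Proof. exact: outer_content_ge0. Qed.

Lemma content_measure_sigma_additive : semi_sigma_additive content_measure.
Proof.
move=> F mF tF mUF; apply: caratheodory_measure_sigma_additive => //.
- by move=> i; exact: borel_caratheodory.
- exact: borel_caratheodory.
Qed.

HB.instance Definition _ := isMeasure.Build _ B R content_measure
  content_measure0 content_measure_ge0 content_measure_sigma_additive.

Variable K : set Y.
Hypotheses (cK : compact K) (mNK : m (~` K) = 0%R) (m1 : m K = 1%R) (mT : m setT = 1%R).

Lemma content_measureT : content_measure setT = 1.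
Proof.
rewrite /content_measure outer_content_open; last exact: openT.
apply/eqP; rewrite eq_le; apply/andP; split.
  by apply: le_trans (inner_content_le_m _) _; rewrite mT.
by apply: le_trans (inner_content_ge cK _); rewrite ?m1.
Qed.

HB.instance Definition _ := Measure_isProbability.Build _ B R content_measure content_measureT.

(** Monotonicity is asserted for arbitrary sets because compact sets and preimages of their images
    occur later without a measurability proof. Inner regularity uses that [K] carries all the mass:
    removing from [K] an open set that covers the complement of A leaves a compact subset of A. *)
Lemma content_probability : exists mu : probability B R,
  [/\ forall A1 A2 : set Y, A1 `<=` A2 -> mu A1 <= mu A2,
      mu (~` K) = 0,
      forall U : set Y, open U -> mu U <= (m U)%:E &
      forall (A : set B) (e : R), measurable A -> (0 < e)%R ->
        exists C : set Y, [/\ compact C, C `<=` A & mu A <= mu C + e%:E]].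
Proof.
have oNK : open (~` K) by apply: closed_openC; exact: compact_closed.
have NK0 : outer_content (~` K) = 0.
  apply/eqP; rewrite eq_le outer_content_ge0 andbT outer_content_open//.
  by apply: le_trans (inner_content_le_m _) _; rewrite mNK.
pose mu : probability B R := content_measure.
exists mu; split => //.
- exact: le_outer_content.
- by move=> U oU; rewrite /= /content_measure outer_content_open// inner_content_le_m.
- move=> A e mA e0; have [_ [U [oU AU] <-] Ue] :=
    lb_ereal_inf_adherent e0 (outer_content_fin (~` A)).
  exists (K `&` ~` U); split.
  + by apply: compact_closedI => //; exact: open_closedC.
  + by move=> x [_ nU]; apply: contrapT => nA; apply: nU; exact: AU.
  + rewrite /= /content_measure.
    (* Caratheodory's identity for A, tested on U: the part of U beyond the complement of A weighs
       at most e. *)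
    have UA : outer_content (U `&` A) <= e%:E.
      have := borel_caratheodory mA U; rewrite (outer_content_open oU).
      have -> : U `&` ~` A = ~` A by apply/setIidr.
      move=> UE; move: Ue; rewrite -/(outer_content (~` A)) UE addeC lteD2lE ?outer_content_fin//.
      exact: ltW.
    have sub : A `<=` (K `&` ~` U) `|` (~` K `|` (U `&` A)).
      move=> x Ax; have [Kx|nKx] := pselect (K x); last by right; left.
      by have [Ux|nUx] := pselect (U x); [right; right|left].
    apply: le_trans (le_outer_content sub) _.
    apply: le_trans (outer_measureU2 _ _ _) _; rewrite leeD2l//.
    by apply: le_trans (outer_measureU2 _ _ _) _; rewrite [X in X + _]NK0 add0e.
Qed.

End Content.

Section RieszMarkov.
Variables (R : realType) (Y : ptopologicalType).

Lemma continuous_borel_measurable (g : Y -> R) : continuous g ->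
  measurable_fun setT (g : borelType Y -> R).
Proof.
move=> /continuousP cg; apply: (measurability _ (RGenOpens.measurableE R)) => //.
move=> _ [_ [a [b ->] <-]]; rewrite setTI.
by apply: sub_sigma_algebra; apply: cg; exact: interval_open.
Qed.

(** Discrete layer-cake formula: y is, up to e, the sum of e over the thresholds below it. The
    thresholds start at e and not at 0, which keeps the sum below y. *)
Lemma layer_sum_le (e y : R) n : 0 < e -> 0 <= y ->
  \sum_(j < n) e * (j.+1%:R * e < y)%R%:R <= y.
Proof.
move=> e0 y0; elim: n => [|n IH]; first by rewrite big_ord0.
rewrite big_ord_recr/=; have [ny|ny] := ltP; last by rewrite mulr0 addr0.
rewrite mulr1; apply: le_trans (ltW ny); rewrite -natr1 mulrDl mul1r lerD2r.
apply: (@le_trans _ _ (\sum_(j < n) e)); last by rewrite sumr_const card_ord mulr_natl.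
by apply: ler_sum => j _; rewrite ler_piMr ?(ltW e0)//; case: (_ < _).
Qed.

Lemma le_layer_sum (e y : R) n : 0 < e -> y <= n%:R * e ->
  y <= e + \sum_(j < n) e * (j.+1%:R * e < y)%R%:R.
Proof.
move=> e0; elim: n => [|n IH] yn; first by rewrite big_ord0; lra.
rewrite big_ord_recr/=; have [yn'|yn'] := leP y (n%:R * e).
  by apply: le_trans (IH yn') _; rewrite addrA lerDl mulr_ge0// ltW.
have -> : \sum_(j < n) e * (j.+1%:R * e < y)%R%:R = n%:R * e.
  under eq_bigr => j _.
    have -> : j.+1%:R * e < y.
      by apply: le_lt_trans yn'; rewrite ler_pM2r// ler_nat.
    rewrite mulr1; over.
  by rewrite sumr_const card_ord mulr_natl.
have := ler0n R (n.+1%:R * e < y)%R; rewrite -natr1 in yn *; nra.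
Qed.

Variables (K : set Y) (L : (Y -> R) -> R).
Hypotheses (Yreg : regular_space Y) (Yhaus : hausdorff_space Y) (cK : compact K).
Hypothesis LD : forall f g, bounded_on K f -> bounded_on K g ->
  L (fun x => f x + g x) = L f + L g.
Hypothesis LZ : forall t f, bounded_on K f -> L (fun x => t * f x) = t * L f.
Hypothesis Lge0 : forall f, bounded_on K f -> (forall x, K x -> 0 <= f x) -> 0 <= L f.
Hypothesis L1 : L (fun=> 1) = 1.

Lemma functional_le f g : bounded_on K f -> bounded_on K g ->
  (forall x, K x -> f x <= g x) -> L f <= L g.
Proof.
move=> bf bg fg; rewrite -subr_ge0.
have := LD bg (bounded_onZ (-1) bf); rewrite LZ// mulN1r => <-.
apply: Lge0; first by apply: bounded_onD => //; exact: bounded_onZ.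
by move=> x Kx; have := fg x Kx; lra.
Qed.

Lemma functional_cst a : L (fun=> a) = a.
Proof.
have h := LZ a (bounded_on_cst K 1); rewrite L1 mulr1 in h; rewrite -[RHS]h.
by congr L; apply/funext => x; rewrite mulr1.
Qed.

Lemma bounded_on_indic (A : set Y) : bounded_on K (\1_A : Y -> R).
Proof. by exists 1 => x _; rewrite ger0_norm// /indic lern1 leq_b1. Qed.

Lemma bounded_on_sum n (F : 'I_n -> Y -> R) : (forall j, bounded_on K (F j)) ->
  bounded_on K (fun x => \sum_(j < n) F j x) /\
  L (fun x => \sum_(j < n) F j x) = \sum_(j < n) L (F j).
Proof.
elim: n F => [|n IH] F bF.
  split; first by exists 0 => x _; rewrite big_ord0 normr0.
  rewrite big_ord0 -[RHS](functional_cst 0); congr L.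
  by apply/funext => x; rewrite big_ord0.
have [b1 e1] := IH (fun j => F (widen_ord (leqnSn n) j)) (fun j => bF _).
have -> : (fun x => \sum_(j < n.+1) F j x) =
    fun x => \sum_(j < n) F (widen_ord (leqnSn n) j) x + F ord_max x.
  by apply/funext => x; rewrite big_ord_recr.
by split; [exact: bounded_onD|rewrite LD// e1 big_ord_recr].
Qed.

Lemma riesz_markov : exists mu : probability (borelType Y) R,
  [/\ forall A B : set Y, A `<=` B -> (mu A <= mu B)%E,
      forall (A : set (borelType Y)) (e : R), measurable A -> 0 < e ->
        exists C : set Y, [/\ compact C, C `<=` A & (mu A <= mu C + e%:E)%E] &
      forall g : Y -> R, continuous g ->
        mu.-integrable setT (EFin \o g) /\ (\int[mu]_x (g x)%:E = (L g)%:E)%E].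
Proof.
pose m (A : set Y) := L \1_A.
have bI := bounded_on_indic.
have m_ge0 A : 0 <= m A by apply: Lge0.
have m_leK (A B : set Y) : (forall x, K x -> A x -> B x) -> m A <= m B.
  move=> AB; apply: functional_le => // x Kx; rewrite /indic.
  have [/set_mem Ax|_] := boolP (x \in A); last exact: ler0n.
  by rewrite mem_set//; exact: AB.
have mU (A B : set Y) : m (A `|` B) <= m A + m B.
  rewrite -LD//; apply: functional_le => //; first exact: bounded_onD.
  move=> x _; rewrite /indic in_setU.
  by case: (x \in A); case: (x \in B); rewrite /= ?addr0 ?add0r// lerDl.
have mD (A B : set Y) : A `&` B = set0 -> m A + m B <= m (A `|` B).
  move=> AB; rewrite -LD//; apply: functional_le => //; first exact: bounded_onD.
  move=> x _; rewrite /indic in_setU; have : x \notin A `&` B by rewrite AB in_set0.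
  by rewrite in_setI; case: (x \in A); case: (x \in B); rewrite /= ?addr0 ?add0r.
have m0 : m set0 = 0.
  by rewrite -(functional_cst 0) /m; congr L; apply/funext => x; rewrite indic0.
have mT : m setT = 1.
  by rewrite -L1 /m; congr L; apply/funext => x; rewrite indicT.
have mK : m K = 1.
  by apply/eqP; rewrite eq_le -{1}mT m_leK//= -mT m_leK.
have mNK : m (~` K) = 0.
  by apply/eqP; rewrite eq_le m_ge0 andbT -m0 m_leK.
have [|mu [mu_le muNK mu_open mu_reg]] :=
  @content_probability R Y m Yreg Yhaus m0 _ mU mD K cK mNK mK mT.
  by move=> A B AB; apply: m_leK => x _; exact: AB.
have Icst (a : R) : (\int[mu]_x a%:E = a%:E)%E.
  rewrite integral_cst// [X in (_ * X)%E](_ : _ = 1%E) ?mule1//.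
  exact: probability_setT.
exists mu; split => //.
(* mu U <= m U is available for open U, so slicing into superlevel sets bounds the integral from
   above only. Equality comes from applying this to h + M and to M - h. *)
have upper (g : Y -> R) M e : continuous g -> 0 < e -> (forall x, 0 <= g x <= M) ->
    (\int[mu]_x (g x)%:E <= (e + L g)%:E)%E.
  move=> cg e0 gM.
  have gM' x : g x <= M by have /andP[] := gM x.
  have g0 x : 0 <= g x by have /andP[] := gM x.
  have bg : bounded_on K g by exists M => x _; rewrite ger0_norm.
  have [n nM] : exists n : nat, M <= n%:R * e.
    exists (Num.trunc (M / e)).+1; rewrite -ler_pdivrMr//.
    exact/ltW/truncnS_gt.
  pose U (j : 'I_n) := [set x | j.+1%:R * e < g x].
  have oU j : open (U j).
    by apply: (open_comp (D := [set y | j.+1%:R * e < y])) => // x _; exact: cg.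
  have UE j x : \1_(U j) x = (j.+1%:R * e < g x)%R%:R :> R.
    by rewrite /indic; congr (_%:R); congr nat_of_bool; apply/idP/idP; rewrite inE.
  have mUj j : measurable (U j : set (borelType Y)) by exact: sub_sigma_algebra.
  have sL : \sum_(j < n) e * m (U j) <= L g.
    have bU j : bounded_on K (fun x => e * \1_(U j) x) by exact: bounded_onZ.
    have [b1 e1] := bounded_on_sum bU.
    rewrite (eq_bigr (fun j => L (fun x => e * \1_(U j) x))); last first.
      by move=> j _; rewrite LZ.
    rewrite -e1; apply: functional_le => // x _.
    by under eq_bigr do rewrite UE; exact: layer_sum_le.
  have mI j : measurable_fun setT (fun x : borelType Y => (e * \1_(U j) x)%:E).
    apply/measurable_EFinP; apply: measurable_funM => //; exact: measurable_indic.
  apply: (@le_trans _ _ (\int[mu]_x ((e%:E + \sum_(j < n) (e * \1_(U j) x)%:E)%E))%E).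
    apply: ge0_le_integral => //.
    - by move=> x _; rewrite lee_fin.
    - by apply/measurable_EFinP; exact: continuous_borel_measurable.
    - by apply: emeasurable_funD => //; exact: emeasurable_sum.
    - move=> x _; rewrite sumEFin -EFinD lee_fin.
      by under eq_bigr do rewrite UE; apply: le_layer_sum => //; exact: le_trans nM.
  have eI0 j x : (0 <= (e * \1_(U j) x)%:E)%E.
    by rewrite lee_fin UE mulr_ge0 ?(ltW e0).
  rewrite ge0_integralD//; last 3 first.
  - by move=> x _; rewrite lee_fin ltW.
  - by move=> x _; apply: sume_ge0 => j _.
  - exact: emeasurable_sum.
  rewrite Icst ge0_integral_sum//.
  rewrite EFinD leeD2l//; apply: le_trans (_ : (\sum_(j < n) (e * m (U j))%:E)%E <= _)%E.
    apply: lee_sum => j _.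
    under eq_integral do rewrite EFinM.
    rewrite ge0_integralZl//; last 2 first.
    - by apply/measurable_EFinP; exact: measurable_indic.
    - by rewrite lee_fin ltW.
    by rewrite integral_indic// setIT EFinM lee_pmul2l// mu_open.
  by rewrite sumEFin lee_fin.
move=> g cg.
have [M M0' gM'] := pinfty_ex_gt0
  (compact_bounded (continuous_compact (continuous_subspaceT cg) cK)).
have gM x : K x -> `|g x| <= M by move=> Kx; apply: gM'; exists x.
have M0 : 0 <= M by exact: ltW.
(* The truncation of g to [-M, M]: the bound M holds on [K], but [upper] needs global bounds.
   Neither mu nor L sees a change outside [K]. *)
pose h x := (`|g x + M| - `|g x - M|) / 2.
have hg x : K x -> h x = g x.
  by move=> /gM; rewrite ler_norml => /andP[a b]; rewrite /h ger0_norm ?ler0_norm; lra.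
have hM x : `|h x| <= M.
  rewrite /h normrM (@gtr0_norm _ 2^-1)//.
  have := ler_dist_dist (g x + M) (g x - M).
  rewrite (_ : g x + M - (g x - M) = 2 * M); last by ring.
  by rewrite (ger0_norm (mulr_ge0 _ M0))//; lra.
have ch : continuous h.
  move=> x; apply: cvgMl; apply: cvgB; apply: cvg_norm.
    by apply: cvgD; [exact: cg|exact: cvg_cst].
  by apply: cvgB; [exact: cg|exact: cvg_cst].
have bh : bounded_on K h by exists M.
have mh := continuous_borel_measurable ch.
have mg := continuous_borel_measurable cg.
have ih : mu.-integrable setT (EFin \o h).
  apply: measurable_bounded_integrable => //; first by apply: (le_lt_trans (probability_le1 mu measurableT)); rewrite ltry.
  by exists M; split; [exact: num_real|move=> y My x _; apply: le_trans (hM x) (ltW My)].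
have aegh : ae_eq mu setT (EFin \o h) (EFin \o g).
  exists (~` K); split => //.
    by apply: sub_sigma_algebra; apply: closed_openC; exact: compact_closed.
  by move=> x /= nh Kx; apply: nh => _; rewrite hg.
have Lgh : L g = L h.
  have bg : bounded_on K g by exists M.
  by apply/eqP; rewrite eq_le; apply/andP; split; apply: functional_le => // x /hg->.
have ig : mu.-integrable setT (EFin \o g).
  apply/integrableP; split; first exact/measurable_EFinP.
  have <- : (\int[mu]_x `|(EFin \o h) x| = \int[mu]_x `|(EFin \o g) x|)%E.
    apply: ae_eq_integral => //.
    + by apply: measurableT_comp => //; exact/measurable_EFinP.
    + by apply: measurableT_comp => //; exact/measurable_EFinP.
    + by apply: filterS aegh => x + Dx => /(_ Dx) ->.
  by have /integrableP[] := ih.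
split => //.
have -> : (\int[mu]_x (g x)%:E = \int[mu]_x (h x)%:E)%E.
  apply: ae_eq_integral => //; [exact/measurable_EFinP|exact/measurable_EFinP|].
  by apply: filterS aegh => x + Dx => /(_ Dx).
rewrite Lgh.
have ifin : (\int[mu]_x (h x)%:E)%E \is a fin_num by exact: integrable_fin_num ih.
have iM : mu.-integrable setT (EFin \o (fun=> M)).
  exact: (finite_measure_integrable_cst mu M measurableT).
have IM : (\int[mu]_x (M%:E) = M%:E)%E.
  exact: Icst.
rewrite -(fineK ifin); congr (_%:E); apply/eqP; rewrite eq_le; apply/andP; split.
  apply/ler_addgt0Pr => e e0.
  have chM : continuous (fun x => h x + M).
    by move=> x; apply: cvgD; [exact: ch|exact: cvg_cst].
  have := @upper (fun x => h x + M) (2 * M) e chM e0.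
  have -> : (\int[mu]_x (h x + M)%:E = \int[mu]_x (h x)%:E + M%:E)%E.
    rewrite -[in RHS]IM -integralD_EFin//.
  rewrite -(fineK ifin) -EFinD lee_fin LD ?functional_cst//; last exact: bounded_on_cst.
  move=> /(_ _)/wrap[]; last by lra.
  by move=> x; have := hM x; rewrite ler_norml => /andP[a b]; apply/andP; split; lra.
apply/ler_addgt0Pr => e e0.
have chM : continuous (fun x => M + -1 * h x).
  by move=> x; apply: cvgD; [exact: cvg_cst|apply: cvgMr; exact: ch].
have := @upper (fun x => M + -1 * h x) (2 * M) e chM e0.
have -> : (\int[mu]_x (M + -1 * h x)%:E = M%:E - \int[mu]_x (h x)%:E)%E.
  rewrite -[in RHS]IM -integralB_EFin//; apply: eq_integral => x _.
  by rewrite -EFinB mulN1r.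
rewrite -(fineK ifin) -EFinB lee_fin LD ?functional_cst ?LZ//; last 2 first.
- exact: bounded_on_cst.
- exact: bounded_onZ.
move=> /(_ _)/wrap[]; last by lra.
by move=> x; have := hM x; rewrite ler_norml => /andP[a b]; apply/andP; split; lra.
Qed.
End RieszMarkov.

(** * The duality gap *)

Section IndexedTopology.
Variables (R : realType) (n : nat).

Lemma continuous_idx (T U : topologicalType) (F : 'I_n.+1 -> T -> U) :
  (forall i, continuous (F i)) -> continuous (fun z : T * idx n => F z.2 z.1).
Proof.
move=> cF [x i] W /= /(cF i x) nW.
exists ((F i @^-1` W), [set i]); first by split => //=.
by move=> [y j] /= [Wy ->].
Qed.

Lemma compact_idx : compact [set: idx n].
Proof.
apply: finite_compact.
exact: (@finite_finset 'I_n.+1).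
Qed.

Lemma hausdorff_setX (T U : topologicalType) :
  hausdorff_space T -> hausdorff_space U -> hausdorff_space (T * U)%type.
Proof.
move=> hT hU [a b] [c e] cl; congr pair.
- apply: hT => A B nA nB.
  have nA' : nbhs (a, b) (fst @^-1` A) by exists (A, setT) => //=; [split => //; exact: filterT|move=> [x y] []].
  have nB' : nbhs (c, e) (fst @^-1` B) by exists (B, setT) => //=; [split => //; exact: filterT|move=> [x y] []].
  by have [z [Az Bz]] := cl _ _ nA' nB'; exists z.1.
- apply: hU => A B nA nB.
  have nA' : nbhs (a, b) (snd @^-1` A) by exists (setT, A) => //=; [split => //; exact: filterT|move=> [x y] []].
  have nB' : nbhs (c, e) (snd @^-1` B) by exists (setT, B) => //=; [split => //; exact: filterT|move=> [x y] []].
  by have [z [Az Bz]] := cl _ _ nA' nB'; exists z.2.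
Qed.

Variable d : nat.
Local Notation V := 'rV[R]_d.
Local Notation lifted := (V * V * idx n)%type.

Lemma regular_lifted : regular_space lifted.
Proof. exact: (@uniform_regular (V * V * discrete_topology 'I_n.+1)%type). Qed.

Lemma hausdorff_lifted : hausdorff_space lifted.
Proof.
apply: hausdorff_setX; first by apply: hausdorff_setX; exact: norm_hausdorff.
exact: (@discrete_hausdorff (discrete_topology 'I_n.+1)).
Qed.

(** All faces are included for compactness. Boundary points represent the same torus point several
    times, but only surjectivity onto the torus matters. *)
Definition cube : set V := [set x | forall j, 0 <= x 0 j <= 1].

Lemma compact_cube : compact cube.
Proof.
have := @compact_box R d (const_mx 2^-1) 2^-1; congr compact.
by apply/seteqP; split => x h j; have := h j; rewrite mxE => /andP[a b]; apply/andP; split; lra.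
Qed.

Definition lifted_domain (P : R) : set lifted :=
  (cube `*` [set p : V | forall j, 0 - P <= p 0 j <= 0 + P]) `*` setT.

Lemma compact_lifted_domain P : compact (lifted_domain P).
Proof.
apply: compact_setX; last exact: compact_idx.
apply: compact_setX; first exact: compact_cube.
have := @compact_box R d 0 P; congr compact.
by apply/seteqP; split => x h j; have := h j; rewrite mxE.
Qed.

Lemma torus_bounded (F : 'I_n.+1 -> torus R d -> R) :
  (forall i, continuous (F i \o @tproj R d)) ->
  exists2 M, 0 <= M & forall i x, `|F i x| <= M.
Proof.
move=> cF.
have cG : continuous (fun z : V * idx n => F z.2 (tproj z.1)).
  by apply: (continuous_idx (F := fun i => F i \o @tproj R d)).
have cK : compact (cube `*` [set: idx n]).
  by apply: compact_setX; [exact: compact_cube|exact: compact_idx].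
have [M M0 FM] := pinfty_ex_gt0
  (compact_bounded (continuous_compact (continuous_subspaceT cG) cK)).
exists M => [|i x]; first exact: ltW.
rewrite -(tproj_repr x); have [T TZ cT] := unit_cube_shift (repr x).
by rewrite -(tproj_shift (repr x) TZ); apply: FM; exists (repr x + T, i).
Qed.

Lemma torus_attains_max (F : 'I_n.+1 -> torus R d -> R) :
  (forall i, continuous (F i \o @tproj R d)) ->
  exists i x, forall j y, F j y <= F i x.
Proof.
move=> cF.
have cG : continuous (fun z : V * idx n => F z.2 (tproj z.1)).
  by apply: (continuous_idx (F := fun i => F i \o @tproj R d)).
have cK : compact (cube `*` [set: idx n]).
  by apply: compact_setX; [exact: compact_cube|exact: compact_idx].
have K0 : cube `*` [set: idx n] !=set0.
  by exists (0, ord0); split => //= j; rewrite mxE lexx ler01.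
have [[x i] _ xmax] := compact_EVT_max K0 cK (continuous_subspaceT cG).
exists i, (tproj x) => j y.
rewrite -(tproj_repr y); have [T TZ cT] := unit_cube_shift (repr y).
rewrite -(tproj_shift (repr y) TZ).
by apply: (xmax (repr y + T, j)); rewrite inE.
Qed.

End IndexedTopology.

Section C1.
Variables (R : realType) (d n : nat).
Local Notation V := 'rV[R]_d.

Lemma C1_continuous (u : V -> R) : is_C1 u -> continuous u.
Proof. by move=> [du _] x; apply: differentiable_continuous; exact: du. Qed.

Lemma C1_combination (u v : V -> R) a b : is_C1 u -> is_C1 v ->
  is_C1 (fun x => a * u x + b * v x) /\
  forall x, grad (fun x => a * u x + b * v x) x = a *: grad u x + b *: grad v x.
Proof.
move=> [du cu] [dv cv].
have E : (fun x => a * u x + b * v x) = (a *: u + b *: v).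
  by apply/funext.
have dE x w : 'D_w (a *: u + b *: v) x = a * 'D_w u x + b * 'D_w v x.
  have du' := @diff_derivable _ _ _ u x w (du x).
  have dv' := @diff_derivable _ _ _ v x w (dv x).
  have du'' := @derivableZ _ _ _ u a x w du'; have dv'' := @derivableZ _ _ _ v b x w dv'.
  rewrite (@deriveD _ _ _ (a *: u) (b *: v) x w du'' dv'').
  by rewrite (@deriveZ _ _ _ u a x w du') (@deriveZ _ _ _ v b x w dv').
rewrite E; split.
  split=> [x|w].
    by apply: differentiableD; apply: differentiableZ.
  rewrite (_ : 'D_w _ = fun x => a * 'D_w u x + b * 'D_w v x); last by apply/funext => x.
  by apply: continuous_funD; apply: continuous_funM => //; exact: continuous_fun_cst.
by move=> x; apply/rowP => j; rewrite !mxE dE.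
Qed.

Lemma C1_grad_continuous (u : V -> R) : is_C1 u -> continuous (grad u).
Proof.
move=> [_ cu]; apply: row_continuous => j.
rewrite (_ : (fun x => _) = 'D_(delta_mx 0 j) u); first exact: cu.
by apply/funext => x; rewrite mxE.
Qed.

Lemma torus_C1_combination (f g : torus R d -> R) a b : torus_C1 f -> torus_C1 g ->
  torus_C1 (fun x => a * f x + b * g x) /\
  forall x, tgrad (fun x => a * f x + b * g x) x = a *: tgrad f x + b *: tgrad g x.
Proof.
move=> Cf Cg; have [C1 gE] := C1_combination a b Cf Cg; split; first exact: C1.
by move=> x; exact: gE.
Qed.

Lemma torus_C1_continuous (f : torus R d -> R) : torus_C1 f -> continuous f.
Proof. by move=> Cf; apply: torus_continuousP; exact: C1_continuous. Qed.

Lemma tgrad_continuous (f : torus R d -> R) : torus_C1 f -> continuous (tgrad f).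
Proof.
move=> Cf; apply: torus_continuousP.
rewrite (_ : tgrad f \o _ = grad (f \o @tproj R d)); first exact: C1_grad_continuous.
by apply/funext => x /=; rewrite tgrad_tproj.
Qed.

Lemma Theta_combination (c : 'I_n.+1 -> 'I_n.+1 -> R) (f g : torus R d -> 'I_n.+1 -> R) a b x i :
  Theta c (fun x i => a * f x i + b * g x i) x i = a * Theta c f x i + b * Theta c g x i.
Proof.
rewrite /Theta !mulr_sumr -big_split/=; apply: eq_bigr => j _; ring.
Qed.

End C1.

Section Key.
Variables (R : realType) (d n : nat).
Local Notation V := 'rV[R]_d.
Variable H : torus R d -> V -> 'I_n.+1 -> R.
Hypothesis H_C2 : forall i, @is_C2 R (V * V)%type (fun z => H (tproj z.1) z.2 i).
Hypothesis A1 : forall x i, @convex_function R V setT (fun p => H x p i).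
Variable C : R.
Hypotheses (C0 : 0 <= C) (A3 : forall x p i, enorm (DxH H x p i) <= C * (1 + enorm p ^+ 2)).
Variable c : 'I_n.+1 -> 'I_n.+1 -> R.
Hypothesis c_ge0 : forall i j, 0 <= c i j.
Variables (v1 v2 : torus R d -> 'I_n.+1 -> R) (K : R).
Hypotheses (K0 : 0 <= K) (v1K : forall i, elipschitz K ((v1 ^~ i) \o @tproj R d)).
Hypotheses (v1_sub : viscosity_subsolution H c v1) (v2_sup : viscosity_supersolution H c v2).

(** The integrand that closed measures annihilate, pulled back to momenta by q = D_pH(x, p, i). *)
Definition closedness (phi : torus R d -> 'I_n.+1 -> R) (x : torus R d) (p : V) i :=
  dot (DpH H x p i) (tgrad (phi ^~ i) x) + Theta c phi x i.

(* L(x, q, i) at q = DpH(x, p, i). *)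
Definition legendre (x : torus R d) (p : V) i := dot p (DpH H x p i) - H x p i.

(* If the gap were closed, then u = (1 - e a) w - e phi, with w a smooth
   approximate subsolution close to v1, would by convexity be a strict
   subsolution, up to e^2, wherever v1 - v2 >= delta / 2 - O(e); a maximum point
   of u - v2 is such a point, and there u is a test function for v2. *)
Lemma duality_gap (z : torus R d) (k : 'I_n.+1) (delta : R) :
  delta = v1 z k - v2 z k -> 0 < delta ->
  forall (phi : torus R d -> 'I_n.+1 -> R) (a b eta : R),
  (forall i, torus_C1 (phi ^~ i)) -> 0 <= a -> 0 <= b -> 0 < eta ->
  exists x p i, enorm p <= 2 * K + 1 /\
    closedness phi x p i + a * legendre x p i - b * (v1 x i - v2 x i - delta / 2) < eta.
Proof.
move=> deltaE d0 phi a b eta C1phi a0 b0 eta0; apply: contrapT => noex.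
have lower x p i : enorm p <= 2 * K + 1 ->
    eta <= closedness phi x p i + a * legendre x p i - b * (v1 x i - v2 x i - delta / 2).
  by move=> pP; rewrite leNgt; apply/negP => lt; apply: noex; exists x, p, i.
have [M1 M10 phiM] : exists2 M, 0 <= M & forall i x, `|phi x i| <= M.
  apply: (@torus_bounded R n d (fun i x => phi x i)) => i.
  exact: (C1_continuous (C1phi i)).
have [M2 M20 gphiM] : exists2 M, 0 <= M & forall i x, `|enorm (tgrad (phi ^~ i) x)| <= M.
  apply: (@torus_bounded R n d (fun i x => enorm (tgrad (phi ^~ i) x))) => i.
  apply: (continuous_fun_comp (g := Num.sqrt)); last exact: sqrt_continuous.
  have cg : continuous (fun x : V => tgrad (phi ^~ i) (tproj x)).
    exact: (continuous_fun_comp (@tproj_continuous R d) (tgrad_continuous (C1phi i))).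
  exact: continuous_dot.
have [B1 B10 v1B] : exists2 M, 0 <= M & forall i x, `|v1 x i| <= M.
  by apply: (@torus_bounded R n d (fun i x => v1 x i)) => i; exact: elipschitz_continuous (v1K i).
(* |u - v1| <= e C': the three terms stem from the accuracy s <= e, from e a w and from e phi. *)
pose C' := 1 + a * (B1 + 1) + M1.
have C'0 : 0 < C' by rewrite /C'; have : 0 <= a * (B1 + 1) by [rewrite mulr_ge0//; lra]; lra.
(* The summands of Q provide, in turn, e a <= 1, e M2 <= 1, e (1 + 2 b C') < eta and e <= 1. *)
pose Q := a + M2 + (1 + 2 * b * C') / eta + 1.
have bC : 0 <= 2 * b * C' by rewrite !mulr_ge0// ltW.
have E0 : 0 < (1 + 2 * b * C') / eta by rewrite divr_gt0// ltr_wpDr.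
have Q0 : 0 < Q by rewrite /Q; lra.
pose e := Q^-1; have e0 : 0 < e by rewrite invr_gt0.
have eQ : e * Q = 1 by rewrite mulVf// gt_eqF.
have e1 : e <= 1 by rewrite -eQ ler_peMr ?(ltW e0)//; rewrite /Q; lra.
have ea1 : e * a <= 1 by rewrite -eQ ler_wpM2l ?(ltW e0)//; rewrite /Q; lra.
have eM1 : e * M2 <= 1 by rewrite -eQ ler_wpM2l ?(ltW e0)//; rewrite /Q; lra.
have eE : e * (1 + 2 * b * C') < eta.
  have k1 : (1 + 2 * b * C') / eta < Q by rewrite /Q; lra.
  by move: k1; rewrite -(ltr_pM2l e0) eQ mulrA ltr_pdivrMr// mul1r.
clearbody e; clear Q0 eQ Q.
pose s := e ^+ 2; have s0 : 0 < s by rewrite exprn_gt0.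
have se : s <= e by rewrite /s expr2 ger_pMr.
have [w [C1w wv wK wsub]] := smooth_subsolution H_C2 A1 C0 A3 c_ge0 v1_sub K0 v1K s0.
pose t := 1 - e * a; have t0 : 0 <= t by rewrite /t; lra.
have t1 : t <= 1 by rewrite /t; have : 0 <= e * a by [rewrite mulr_ge0// ltW]; lra.
pose u x i := t * w x i + (- e) * phi x i.
have uC1 i := torus_C1_combination t (- e) (C1w i) (C1phi i).
have cv2 i : continuous (v2 ^~ i) by have [] := v2_sup.
have [i [x xmax]] : exists i x, forall j y, u y j - v2 y j <= u x i - v2 x i.
  apply: (@torus_attains_max R n d (fun i x => u x i - v2 x i)) => i.
  apply: continuous_funB; first exact: (C1_continuous (uC1 i).1).
  exact: (continuous_fun_comp (@tproj_continuous R d) (cv2 i)).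
have h1 : 0 <= H x (tgrad (u ^~ i) x) i + Theta c v2 x i.
  have [_ h] := v2_sup; apply: h; first exact: (uC1 i).1.
  by move=> y; have := xmax i y; lra.
have h2 : Theta c v2 x i <= Theta c u x i.
  by apply: ThetaB_max => // j; exact: xmax.
have uv y j : `|u y j - v1 y j| <= e * C'.
  have -> : u y j - v1 y j = (w y j - v1 y j) - e * a * w y j - e * phi y j.
    by rewrite /u /t; ring.
  have hw := wv y j; have hp := phiM j y; have hv := v1B j y.
  have hw' : `|w y j| <= B1 + 1.
    rewrite (_ : w y j = (w y j - v1 y j) + v1 y j); last ring.
    by apply: le_trans (ler_normD _ _) _; lra.
  apply: le_trans (ler_normB _ _) _; rewrite normrM (gtr0_norm e0).
  have hb := ler_normB (w y j - v1 y j) (e * a * w y j).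
  rewrite normrM (ger0_norm (mulr_ge0 (ltW e0) a0)) in hb.
  have k1 : e * a * `|w y j| <= e * a * (B1 + 1) by rewrite ler_wpM2l// mulr_ge0// ltW.
  have k2 : e * `|phi y j| <= e * M1 by rewrite ler_wpM2l// ltW.
  by rewrite /C'; lra.
(* The maximum of u - v2 is at least its value at (z, k), and u is within e C' of v1 at both
   points. *)
have h3 : delta - 2 * (e * C') <= v1 x i - v2 x i.
  have := xmax k z; have := uv z k; have := uv x i.
  by rewrite !ler_norml => /andP[a1 a2] /andP[b1 b2]; lra.
pose p1 := tgrad (w ^~ i) x; pose gp := tgrad (phi ^~ i) x; pose pe := tgrad (u ^~ i) x.
have peE : pe = t *: p1 + (- e) *: gp by exact: (uC1 i).2.
have peK : enorm pe <= 2 * K + 1.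
  rewrite peE; apply: le_trans (enormD _ _) _; rewrite !enormZ normrN (ger0_norm t0) (gtr0_norm e0).
  have := wK x i; have := gphiM i x; rewrite -/p1 -/gp (ger0_norm (enorm_ge0 _)) => k1 k2.
  have k3 : t * enorm p1 <= enorm p1 by rewrite ler_piMl ?enorm_ge0.
  have k4 : e * enorm gp <= e * M2 by rewrite ler_wpM2l// ltW.
  lra.
(* Convexity is used through the tangent at pe, evaluated at p1: this produces the slope q at which
   the cone is tested and involves no division by t. *)
have h4 := hamiltonian_tangent H_C2 A1 x pe p1 i.
have h5 := lower x pe i peK; rewrite /closedness /legendre -/gp in h5.
have h6 := wsub x i; rewrite -/p1 in h6.
have ThU : Theta c u x i = t * Theta c w x i + (- e) * Theta c phi x i.
  exact: Theta_combination.
set q := DpH H x pe i in h4 h5; rewrite -/pe in h1.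
have tp : t * dot q p1 = dot q pe + e * dot q gp.
  by rewrite peE !dotE; ring.
have h7 : t * (H x pe i + dot q (p1 - pe)) <= t * H x p1 i by rewrite ler_wpM2l.
have h8 : t * (H x p1 i + Theta c w x i) <= s.
  by apply: le_trans (_ : t * s <= _); [rewrite ler_wpM2l|rewrite ler_piMl// ltW].
rewrite dotDr dotNr in h7; rewrite (dotC pe) in h5.
have h9 : e * (eta + b * (v1 x i - v2 x i - delta / 2)) <=
   e * (dot q gp + Theta c phi x i + a * (dot q pe - H x pe i)).
  by rewrite ler_wpM2l ?(ltW e0)//; lra.
have h10 : b * (delta / 2 - 2 * (e * C')) <= b * (v1 x i - v2 x i - delta / 2).
  by rewrite ler_wpM2l//; lra.
have h11 : e * (eta - b * (2 * (e * C'))) <= e * (eta + b * (v1 x i - v2 x i - delta / 2)).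
  rewrite ler_wpM2l ?(ltW e0)//; have : 0 <= b * (delta / 2) by rewrite mulr_ge0//; lra.
  lra.
(* In H(x, pe) = t H(x, pe) + e a H(x, pe), the second part joins e a (q . pe) to form the term e a
   [legendre]. *)
have h12 : e * (eta - b * (2 * (e * C'))) <= s.
  apply: le_trans h11 _; apply: le_trans h9 _; rewrite ThU in h2.
  have tE : t = 1 - e * a by [].
  have h7' : t * H x pe i + (dot q pe + e * dot q gp) - t * dot q pe <= t * H x p1 i.
    by rewrite -tp; lra.
  rewrite tE in h7' h8 h2; lra.
have : e * (eta - b * (2 * (e * C'))) <= e * e by rewrite -expr2.
by rewrite ler_pM2l//; lra.
Qed.

End Key.

(** * Mather measures from the positive functional *)

HB.instance Definition _ (A B : ptopologicalType) := Pointed.on (A * B)%type.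

Section BorelMeasures.
Variable R : realType.

Lemma continuous_borel_fun (X Y : ptopologicalType) (F : X -> Y) : continuous F ->
  measurable_fun setT (F : borelType X -> borelType Y).
Proof.
move=> /continuousP cF.
have h := @measurability _ _ (borelType X) (borelType Y) setT F (@open Y : set (set (borelType Y))) erefl.
apply: h => //.
by move=> _ [U oU <-]; rewrite setTI; apply: sub_sigma_algebra; exact: cF.
Qed.

Lemma image_probability d1 d2 (X : measurableType d1) (Y : measurableType d2)
    (mu : probability X R) (F : X -> Y) : measurable_fun setT F ->
  exists nu : probability Y R, (forall A, nu A = mu (F @^-1` A)) /\
    forall f : Y -> \bar R, measurable_fun setT f -> mu.-integrable setT (f \o F) ->
      nu.-integrable setT f /\ (\int[nu]_y f y = \int[mu]_x (f \o F) x)%E.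
Proof.
move=> mF; pose F' : {mfun X >-> Y} := mfun_Sub (mem_set mF).
exists (distribution mu F'); split => // f mf intf; split.
  exact: (integrable_pushforward mF mf intf).
exact: (integral_pushforward mF mf intf).
Qed.

(** Only the lower function is integrable, since the Lagrangian may have infinite integral; the
    positive and negative parts are compared separately. *)
Lemma le_integral_lower d1 (X : measurableType d1) (mu : {measure set X -> \bar R})
    (f g : X -> \bar R) : mu.-integrable setT f -> measurable_fun setT g ->
  (forall x, f x <= g x)%E -> (\int[mu]_x f x <= \int[mu]_x g x)%E.
Proof.
move=> intf mg fg; have mf := measurable_int _ intf.
rewrite (integralE _ _ f) (integralE _ _ g); apply: leeB.
  apply: ge0_le_integral => //.
  - exact: measurable_funepos.
  - exact: measurable_funepos.
  - by move=> x _; rewrite !funeposE ge_max !le_max fg lexx orbT.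
apply: ge0_le_integral => //.
- exact: measurable_funeneg.
- exact: measurable_funeneg.
- by move=> x _; rewrite !funenegE ge_max !le_max leeN2 fg lexx orbT.
Qed.

(** By inner regularity it suffices to bound compact subsets of the preimage, and each is covered by
    finitely many null preimages. *)
Lemma null_of_locally_null (T : topologicalType) (Y : ptopologicalType) (mu : probability (borelType Y) R)
    (G : Y -> T) (U : set T) :
  (forall A B : set Y, A `<=` B -> (mu A <= mu B)%E) ->
  (forall (A : set (borelType Y)) (e : R), measurable A -> 0 < e ->
        exists C : set Y, [/\ compact C, C `<=` A & (mu A <= mu C + e%:E)%E]) ->
  continuous G -> open U ->
  (forall x, U x -> exists2 O, open_nbhs x O & mu (G @^-1` O) = 0%E) ->
  mu (G @^-1` U) = 0%E.
Proof.
move=> mu_le mu_reg cG oU Unull; apply/eqP; rewrite eq_le measure_ge0 andbT.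
have oG W : open W -> open (G @^-1` W) by move/continuousP: cG => cG; exact: cG.
have mG W : open W -> measurable (G @^-1` W : set (borelType Y)).
  by move=> oW; apply: sub_sigma_algebra; exact: oG.
apply/lee_addgt0Pr => e e0.
have [B [cB BU /le_trans]] := mu_reg _ e (mG _ oU) e0; apply; rewrite leeD2r//.
have h x : exists N : set T, U x -> open_nbhs x N /\ mu (G @^-1` N) = 0%E.
  have [Ux|nUx] := pselect (U x); last by exists setT.
  by have [N oN N0] := Unull x Ux; exists N.
have /choice[N NP] := h.
have := cB; rewrite compact_cover => /(_ Y B (fun z => G @^-1` N (G z)))[z Bz||D DB BD].
- by apply: oG; have [[]] := NP _ (BU z Bz).
- by move=> z Bz; exists z => //=; have [[]] := NP _ (BU z Bz).
apply: le_trans (mu_le _ _ BD) _.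
rewrite /cover bigcup_fset.
have : forall z, z \in enum_fset D -> measurable (G @^-1` N (G z) : set (borelType Y)) /\ mu (G @^-1` N (G z)) = 0%E.
  move=> z zD; have Bz := set_mem (DB z zD).
  by have [[oN _] N0] := NP _ (BU z Bz); split => //; exact: mG.
move: (enum_fset D) => s hs.
suff [] : measurable (\big[setU/set0]_(i <- s) (G @^-1` N (G i)) : set (borelType Y)) /\
  mu (\big[setU/set0]_(i <- s) (G @^-1` N (G i))) = 0%E by move=> _ ->.
elim: s hs => [|y r IH] hs; first by rewrite big_nil measure0; split.
rewrite big_cons; have [mr r0] := IH (fun x xr => hs x (mem_behead (s := y :: r) xr)).
have [my y0] := hs y (mem_head _ _).
by split; [exact: measurableU|rewrite measureU0].
Qed.

End BorelMeasures.

Section FunContinuity.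
Variables (T U W : topologicalType).

Lemma continuous_fst : continuous (fst : T * U -> T).
Proof. by move=> z; exact: cvg_fst. Qed.

Lemma continuous_snd : continuous (snd : T * U -> U).
Proof. by move=> z; exact: cvg_snd. Qed.

Lemma continuous_pair_fun (f : T -> U) (g : T -> W) :
  continuous f -> continuous g -> continuous (fun x => (f x, g x)).
Proof. by move=> cf cg x; apply: cvg_pair; [exact: cf|exact: cg]. Qed.

End FunContinuity.

Section PhaseSpace.
Variables (R : realType) (d n : nat).
Local Notation V := 'rV[R]_d.
Local Notation lifted := (V * V * idx n)%type.
Variable H : torus R d -> V -> 'I_n.+1 -> R.
Hypothesis H_C2 : forall i, @is_C2 R (V * V)%type (fun z => H (tproj z.1) z.2 i).
Hypothesis A1 : forall x i, @convex_function R V setT (fun p => H x p i).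
Variable c : 'I_n.+1 -> 'I_n.+1 -> R.

Definition legendre_map (z : lifted) : phase R d n :=
  (tproj z.1.1, DpH H (tproj z.1.1) z.1.2 z.2, z.2).

Lemma legendre_map_continuous : continuous legendre_map.
Proof.
apply: continuous_pair_fun; last exact: continuous_snd.
apply: continuous_pair_fun.
  apply: (continuous_fun_comp (g := fun z : V * V => tproj z.1)); first exact: continuous_fst.
  by apply: (continuous_fun_comp (@continuous_fst V V)); exact: tproj_continuous.
apply: (continuous_idx (F := fun i (z : V * V) => DpH H (tproj z.1) z.2 i)) => i.
exact: DpH_continuous.
Qed.

Lemma Theta_continuous (phi : torus R d -> 'I_n.+1 -> R) i :
  (forall i, continuous (phi ^~ i)) -> continuous (fun x => Theta c phi x i).
Proof.
move=> cphi; apply: continuous_fun_sum => j; apply: continuous_funM.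
  exact: continuous_fun_cst.
by apply: continuous_funB; exact: cphi.
Qed.

Definition test_integrand (phi : torus R d -> 'I_n.+1 -> R) (z : phase R d n) : R :=
  let: (x, q, i) := z in dot q (tgrad (phi ^~ i) x) + Theta c phi x i.

Lemma test_integrand_continuous phi : (forall i, torus_C1 (phi ^~ i)) ->
  continuous (test_integrand phi).
Proof.
move=> C1phi.
pose F i (z : torus R d * V) := dot z.2 (tgrad (phi ^~ i) z.1) + Theta c phi z.1 i.
rewrite (_ : test_integrand phi = fun z => F z.2 z.1); last by apply/funext => -[[x q] i].
apply: continuous_idx => i; apply: continuous_funD.
  apply: continuous_dot; first exact: continuous_snd.
  by apply: (continuous_fun_comp (@continuous_fst _ _)); exact: tgrad_continuous.
apply: (continuous_fun_comp (@continuous_fst _ _) (g := fun x => Theta c phi x i)).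
by apply: Theta_continuous => j; exact: torus_C1_continuous.
Qed.

Lemma closedness_combination phi psi a b x p i :
  (forall i, torus_C1 (phi ^~ i)) -> (forall i, torus_C1 (psi ^~ i)) ->
  closedness H c (fun x i => a * phi x i + b * psi x i) x p i =
  a * closedness H c phi x p i + b * closedness H c psi x p i.
Proof.
move=> Cphi Cpsi; rewrite /closedness Theta_combination.
have [_ gE] := torus_C1_combination a b (Cphi i) (Cpsi i).
rewrite (gE x) !dotE; ring.
Qed.

Lemma zero_C1 i : torus_C1 ((fun (_ : torus R d) (_ : 'I_n.+1) => 0 : R) ^~ i).
Proof.
split=> [x|v]; first exact: differentiable_cst.
rewrite (_ : 'D_v _ = fun=> 0); first exact: continuous_fun_cst.
by apply/funext => x; exact: derive_cst.
Qed.

Lemma closedness_zero x p i : closedness H c (fun _ _ => 0) x p i = 0.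
Proof.
rewrite /closedness (_ : tgrad _ x = 0); last first.
  by apply/rowP => j; rewrite !mxE; exact: derive_cst.
by rewrite dot0r add0r /Theta big1// => j _; rewrite subrr mulr0.
Qed.

Lemma hamiltonian_torus_continuous p i : continuous (fun x => H x p i).
Proof.
apply: torus_continuousP.
apply: (continuous_fun_comp (f := fun x : V => (x, p)) (g := fun z : V * V => H (tproj z.1) z.2 i)).
  have cid : continuous (fun x : V => x) by move=> x; exact: cvg_id.
  exact: (continuous_pair_fun cid (@continuous_fun_cst R V V p)).
exact: hamiltonian_continuous.
Qed.

Lemma legendre_continuous :
  continuous (fun z : lifted => legendre H (tproj z.1.1) z.1.2 z.2).
Proof.
apply: (continuous_idx (F := fun i (z : V * V) => legendre H (tproj z.1) z.2 i)) => i.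
apply: continuous_funB; last exact: hamiltonian_continuous.
by apply: continuous_dot; [exact: continuous_snd|exact: DpH_continuous].
Qed.

(** By convexity H lies above its tangent at p, so the supremum is attained at p. *)
Lemma lagrangian_DpH x p i : lagrangian H x (DpH H x p i) i = (legendre H x p i)%:E.
Proof.
apply/eqP; rewrite eq_le; apply/andP; split.
  apply: ge_ereal_sup => _ [p' _ <-]; rewrite lee_fin /legendre.
  have := hamiltonian_tangent H_C2 A1 x p p' i.
  by rewrite dotDr dotNr (dotC p') (dotC p); lra.
by apply: ereal_sup_ubound; exists p.
Qed.

Lemma lagrangian_ge x q p i : ((dot p q - H x p i)%:E <= lagrangian H x q i)%E.
Proof. by apply: ereal_sup_ubound; exists p. Qed.

(** A supremum of continuous functions is lower semicontinuous: its strict superlevel sets are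
    unions of open sets. *)
Lemma lagrangian_measurable : measurable_fun setT
  (fun z : borelType (phase R d n) => lagrangian H z.1.1 z.1.2 z.2).
Proof.
apply: (measurability _ (ErealGenOInfty.measurableE R)) => //.
move=> _ [_ [a ->] <-]; rewrite setTI; apply: sub_sigma_algebra.
rewrite (_ : _ @^-1` _ = \bigcup_(p : V) [set z : phase R d n | a < dot p z.1.2 - H z.1.1 p z.2]).
  apply: bigcup_open => p _.
  apply: (open_comp (D := [set y | a < y])); last exact: open_gt.
  move=> z _; pose F i (z : torus R d * V) := dot p z.2 - H z.1 p i.
  apply: (continuous_idx (F := F)) => i; apply: continuous_funB.
    by apply: continuous_dot; [exact: continuous_fun_cst|exact: continuous_snd].
  exact: (continuous_fun_comp (@continuous_fst _ _) (@hamiltonian_torus_continuous p i)).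
apply/seteqP; split => z /=.
  rewrite in_itv/= andbT => /ereal_sup_gt[_ [p _ <-]]; rewrite lte_fin => lt.
  by exists p.
by move=> [p _ lt]; rewrite in_itv/= andbT; apply: lt_le_trans (lagrangian_ge _ _ p _); rewrite lte_fin.
Qed.

Lemma lagrangian_legendre_map z :
  lagrangian H (legendre_map z).1.1 (legendre_map z).1.2 (legendre_map z).2 =
  (legendre H (tproj z.1.1) z.1.2 z.2)%:E.
Proof. exact: lagrangian_DpH. Qed.

Variable C : R.
Hypotheses (C0 : 0 <= C) (A3 : forall x p i, enorm (DxH H x p i) <= C * (1 + enorm p ^+ 2)).
Hypothesis c_ge0 : forall i j, 0 <= c i j.

(** The subsolution inequality bounds -H(x, Dw, i) below by Theta w - s, which completes q . Dw to
    the integrand annihilated by closed measures; s is arbitrary. *)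
Lemma closed_action_ge0 (v : torus R d -> 'I_n.+1 -> R) (K : R) nu :
  0 <= K -> (forall i, elipschitz K ((v ^~ i) \o @tproj R d)) ->
  viscosity_subsolution H c v -> closed_measure c nu -> (0 <= action H nu)%E.
Proof.
move=> K0 vK vsub [_ nucl]; apply/lee_addgt0Pr => s s0.
have [w [C1w _ _ wsub]] := smooth_subsolution H_C2 A1 C0 A3 c_ge0 vsub K0 vK s0.
have [intg intg0] := nucl w C1w.
have ints : nu.-integrable setT (EFin \o cst s) by exact: finite_measure_integrable_cst.
have intf : nu.-integrable setT (fun z => (test_integrand w z)%:E - s%:E)%E.
  exact: integrableB.
have : (\int[nu]_z ((test_integrand w z)%:E - s%:E) <= action H nu)%E.
  apply: le_integral_lower => //; first exact: lagrangian_measurable.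
  move=> [[x q] i] /=; apply: le_trans (lagrangian_ge _ _ (tgrad (w ^~ i) x) _).
  rewrite -EFinB lee_fin; have := wsub x i; rewrite dotC; lra.
rewrite integralB_EFin//.
have -> : (\int[nu]_z (test_integrand w z)%:E = 0)%E by exact: intg0.
rewrite sub0e integral_cst// [X in (_ * X)%E](_ : _ = 1%E); last exact: probability_setT.
by rewrite mule1 => h; rewrite -leeBlDr// sub0e.
Qed.

End PhaseSpace.

(** * Comparison of a subsolution with a supersolution *)

Section Main.
Variables (R : realType) (d n : nat).
Local Notation V := 'rV[R]_d.
Local Notation lifted := (V * V * idx n)%type.
Variable H : torus R d -> V -> 'I_n.+1 -> R.
Hypothesis H_C2 : forall i, @is_C2 R (V * V)%type (fun z => H (tproj z.1) z.2 i).
Hypothesis A1 : forall x i, @convex_function R V setT (fun p => H x p i).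
Variable C : R.
Hypotheses (C0 : 0 <= C) (A3 : forall x p i, enorm (DxH H x p i) <= C * (1 + enorm p ^+ 2)).
Variable c : 'I_n.+1 -> 'I_n.+1 -> R.
Hypothesis c_ge0 : forall i j, 0 <= c i j.
Variables (v1 v2 : torus R d -> 'I_n.+1 -> R) (K : R).
Hypotheses (K0 : 0 <= K) (v1K : forall i, elipschitz K ((v1 ^~ i) \o @tproj R d)).
Hypotheses (v1_sub : viscosity_subsolution H c v1) (v2_sup : viscosity_supersolution H c v2).

Definition gap_integrand (delta a b : R) (phi : torus R d -> 'I_n.+1 -> R) (z : lifted) : R :=
  closedness H c phi (tproj z.1.1) z.1.2 z.2 + a * legendre H (tproj z.1.1) z.1.2 z.2
  - b * (v1 (tproj z.1.1) z.2 - v2 (tproj z.1.1) z.2 - delta / 2).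

Lemma difference_continuous :
  continuous (fun z : lifted => v1 (tproj z.1.1) z.2 - v2 (tproj z.1.1) z.2).
Proof.
have [cv2 _] := v2_sup; have [cv1 _] := v1_sub.
apply: (continuous_idx (F := fun i (z : V * V) => v1 (tproj z.1) i - v2 (tproj z.1) i)) => i.
have ct : continuous (fun z : V * V => tproj z.1).
  exact: (continuous_fun_comp (@continuous_fst V V) (@tproj_continuous R d)).
by apply: continuous_funB; [exact: (continuous_fun_comp ct (cv1 i))|exact: (continuous_fun_comp ct (cv2 i))].
Qed.

Lemma gap_integrand_continuous delta a b phi : (forall i, torus_C1 (phi ^~ i)) ->
  continuous (gap_integrand delta a b phi).
Proof.
move=> C1phi; apply: continuous_funB.
  apply: continuous_funD.
    apply: (continuous_fun_comp (f := legendre_map H) (g := test_integrand c phi)).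
      exact: legendre_map_continuous.
    exact: test_integrand_continuous.
  by apply: continuous_funM; [exact: continuous_fun_cst|exact: legendre_continuous].
apply: continuous_funM; first exact: continuous_fun_cst.
by apply: continuous_funB; [exact: difference_continuous|exact: continuous_fun_cst].
Qed.

Lemma subsolution_le_supersolution :
  (forall x i, mather_set H c (x, i) -> v1 x i = v2 x i) ->
  forall x i, v1 x i <= v2 x i.
Proof.
move=> v12 x0 i0; rewrite leNgt; apply/negP => lt12.
pose delta := v1 x0 i0 - v2 x0 i0; have d0 : 0 < delta by rewrite subr_gt0.
pose D := @lifted_domain R n d (2 * K + 1).
have cD : compact D by exact: compact_lifted_domain.
pose Cone (g : lifted -> R) := exists phi a b, [/\ forall i, torus_C1 (phi ^~ i), 0 <= a, 0 <= b &
  g = gap_integrand delta a b phi].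
have cont_bounded (g : lifted -> R) : continuous g -> bounded_on D g.
  move=> cg; have [M M0 gM] := pinfty_ex_gt0
    (compact_bounded (continuous_compact (continuous_subspaceT cg) cD)).
  by exists M => z Dz; apply: gM; exists z.
have ConeB g : Cone g -> bounded_on D g.
  by move=> [phi [a [b [C1phi _ _ ->]]]]; apply: cont_bounded; exact: gap_integrand_continuous.
have Cone0 : Cone (fun=> 0).
  exists (fun _ _ => 0), 0, 0; split => //; first exact: zero_C1.
  by apply/funext => z; rewrite /gap_integrand closedness_zero; ring.
have ConeD g h : Cone g -> Cone h -> Cone (fun z => g z + h z).
  move=> [phi [a [b [C1phi a0 b0 ->]]]] [psi [a' [b' [C1psi a0' b0' ->]]]].
  exists (fun x i => 1 * phi x i + 1 * psi x i), (a + a'), (b + b'); split; [|exact: addr_ge0|exact: addr_ge0|].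
    by move=> i; have [] := torus_C1_combination 1 1 (C1phi i) (C1psi i).
  by apply/funext => z; rewrite /gap_integrand closedness_combination//; ring.
have ConeZ t g : 0 < t -> Cone g -> Cone (fun z => t * g z).
  move=> t0 [phi [a [b [C1phi a0 b0 ->]]]].
  exists (fun x i => t * phi x i + 0 * phi x i), (t * a), (t * b).
  split; [|by rewrite mulr_ge0// ltW|by rewrite mulr_ge0// ltW|].
    by move=> i; have [] := torus_C1_combination t 0 (C1phi i) (C1phi i).
  by apply/funext => z; rewrite /gap_integrand closedness_combination//; ring.
have ConeS g eta : Cone g -> 0 < eta -> exists2 z, D z & g z < eta.
  move=> [phi [a [b [C1phi a0 b0 ->]]]] eta0.
  have [x [p [i [pP lt]]]] := duality_gap H_C2 A1 C0 A3 c_ge0 K0 v1K v1_sub v2_sup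
    (erefl delta) d0 C1phi a0 b0 eta0.
  (* The integrand is periodic in x, so the point found may be moved into the cube. *)
  have [T TZ cT] := unit_cube_shift (repr x).
  exists (repr x + T, p, i); last by rewrite /gap_integrand/= tproj_shift// tproj_repr.
  split => //=; split => //= j; have := normr_coord_le_enorm p j.
  by rewrite ler_norml => /andP[a1 a2]; apply/andP; split; lra.
have [L [LD LZ Lge0 L1 LC]] := positive_functional ConeB Cone0 ConeD ConeZ ConeS.
have [mu [mu_le mu_reg mu_int]] := @riesz_markov R lifted D L (@regular_lifted R n d) (@hausdorff_lifted R n d)
   cD LD LZ Lge0 L1.
have mF : measurable_fun setT (legendre_map H : borelType lifted -> borelType (phase R d n)).
  by apply: continuous_borel_fun; exact: legendre_map_continuous.
have [nu [nuE nu_int]] := image_probability mu mF.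
(* A compact set nearly filling the preimage of A has a compact image, which lies in A and has at
   least the same measure. *)
have nu_radon : radon nu.
  move=> A mA; apply/eqP; rewrite eq_le; apply/andP; split; last first.
    by apply: ge_ereal_sup => _ [B [_ BA] <-]; rewrite !nuE; apply: mu_le => z; exact: BA.
  apply/lee_addgt0Pr => e e0.
  have mFA : measurable (legendre_map H @^-1` A : set (borelType lifted)).
    by rewrite -[X in measurable X]setTI; exact: mF.
  have [B [cB BA muB]] := mu_reg _ e mFA e0.
  rewrite nuE; apply: le_trans muB _; rewrite leeD2r//.
  apply: le_trans (ereal_sup_ubound _); last first.
    exists (legendre_map H @` B) => //; split; last by move=> _ [z Bz <-]; exact: BA.
    apply: continuous_compact => //; apply: continuous_subspaceT.
    exact: legendre_map_continuous.
  by apply: mu_le => z Bz; exists z.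
have nu_closed : closed_measure c nu.
  split => // phi C1phi g.
  have cg : continuous (test_integrand c phi) by exact: test_integrand_continuous.
  have cgF : continuous (gap_integrand delta 0 0 phi) by exact: gap_integrand_continuous.
  have gE : test_integrand c phi \o legendre_map H = gap_integrand delta 0 0 phi.
    by apply/funext => z; rewrite /gap_integrand/= mul0r addr0 mul0r subr0.
  have [intF IF] := mu_int _ cgF.
  have mg : measurable_fun setT (EFin \o (test_integrand c phi : borelType (phase R d n) -> R)).
    by apply/measurable_EFinP; exact: continuous_borel_measurable.
  have [|intg Ig] := nu_int (EFin \o test_integrand c phi) mg.
    by rewrite -compA gE.
  split; first exact: intg.
  rewrite [LHS]Ig -[RHS]/(0%:E).
  (* For a = b = 0 the cone contains the elements of both phi and -phi, so L vanishes there. *)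
  have L0 : L (gap_integrand delta 0 0 phi) = 0.
    apply/eqP; rewrite eq_le; apply/andP; split.
      by apply: LC; exists phi, 0, 0.
    rewrite -oppr_le0 -mulN1r -LZ; last by exact: cont_bounded.
    apply: LC; exists (fun x i => -1 * phi x i + 0 * phi x i), 0, 0; split => //.
      by move=> i; have [] := torus_C1_combination (-1) 0 (C1phi i) (C1phi i).
    by apply/funext => z; rewrite /gap_integrand closedness_combination//; ring.
  rewrite L0 in IF.
  by rewrite -IF; apply: eq_integral => z _; rewrite /= -gE.
have nu_action : (action H nu <= 0)%E.
  pose l (z : lifted) := legendre H (tproj z.1.1) z.1.2 z.2.
  have [intl Il] := mu_int l (legendre_continuous H_C2).
  pose La (z : phase R d n) := lagrangian H z.1.1 z.1.2 z.2.
  have lE : La \o legendre_map H = EFin \o l.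
    by apply/funext => z; exact: lagrangian_legendre_map.
  have [|_] := nu_int La (lagrangian_measurable H_C2); first by rewrite lE.
  rewrite -/(action H nu) => ->; rewrite lE [leLHS]Il lee_fin; apply: LC.
  exists (fun _ _ => 0), 1, 0; split => //; first exact: zero_C1.
  by apply/funext => z; rewrite /gap_integrand closedness_zero /l; ring.
have nu_mather : mather_measures H c nu.
  split => // nu' nu'_closed; apply: le_trans nu_action _.
  exact: (closed_action_ge0 H_C2 A1 C0 A3 c_ge0 K0 v1K v1_sub).
pose w (z : lifted) := v1 (tproj z.1.1) z.2 - v2 (tproj z.1.1) z.2.
have cw : continuous w := difference_continuous.
pose G (z : lifted) : base R d n := (tproj z.1.1, z.2).
have cG : continuous G.
  apply: continuous_pair_fun; last exact: continuous_snd.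
  apply: (continuous_fun_comp (g := fun z : V * V => tproj z.1)); first exact: continuous_fst.
  exact: (continuous_fun_comp (@continuous_fst V V) (@tproj_continuous R d)).
pose U := [set y : base R d n | 0 < v1 y.1 y.2 - v2 y.1 y.2].
have oU : open U.
  have cf : continuous (fun y : base R d n => v1 y.1 y.2 - v2 y.1 y.2).
    apply: (continuous_idx (F := fun i x => v1 x i - v2 x i)) => i.
    have [cv2 _] := v2_sup; have [cv1 _] := v1_sub.
    by apply: continuous_funB.
  exact: (open_comp (fun y _ => cf y) (@open_gt R 0)).
(* v1 and v2 differ on U, so U misses the Mather set and hence the support of the marginal of nu:
   each of its points has a null neighbourhood. *)
have muU : mu (G @^-1` U) = 0%E.
  apply: null_of_locally_null => // -[x i] Uxi.
  have nsupp : ~ supp (pushforward nu (@phase_to_base R d n)) (x, i).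
    move=> sxi; have : mather_set H c (x, i).
      by apply: subset_closure; exists nu.
    by move/v12 => vE; move: Uxi; rewrite /U/= vE subrr ltxx.
  move/existsNP: nsupp => [W /not_implyP[oW /negP]]; rewrite -leNgt => W0.
  exists W => //; apply/eqP; rewrite eq_le measure_ge0 andbT.
  by move: W0; rewrite /pushforward nuE.
have cwN : continuous (fun z => -1 * w z).
  by apply: continuous_funM => //; exact: continuous_fun_cst.
have [intw Iw] := mu_int _ cwN.
have Lw : 0 <= L (fun z => -1 * w z).
  rewrite -lee_fin -Iw.
  have mU : measurable (G @^-1` U : set (borelType lifted)).
    by apply: sub_sigma_algebra; move/continuousP: cG; exact.
  rewrite (negligible_integral mU measurableT intw muU).
  apply: integral_ge0 => z [_ /negP]; rewrite /U/= -leNgt lee_fin /w => h.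
  by rewrite mulN1r oppr_ge0.
have bw : bounded_on D (fun z => -1 * w z) by exact: cont_bounded.
(* The cone element with phi = 0, a = 0 and b = 1 gives L(-w) + delta/2 <= 0, against L(-w) >= 0. *)
have : L (fun z => -1 * w z + delta / 2) <= 0.
  apply: LC; exists (fun _ _ => 0), 0, 1; split => //; first exact: zero_C1.
  by apply/funext => z; rewrite /gap_integrand closedness_zero /w; ring.
rewrite LD//; last exact: bounded_on_cst.
have -> : L (fun=> delta / 2) = delta / 2.
  by rewrite (functional_cst LZ L1).
lra.
Qed.

End Main.

Theorem mainTheorem2 (R : realType) (d n : nat)
    (H : torus R d -> 'rV[R]_d -> 'I_n.+1 -> R)
    (c : 'I_n.+1 -> 'I_n.+1 -> R)
    (hd : (0 < d)%N)
    (c_ge0 : forall i j, 0 <= c i j)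
    (H_C2 : forall i, @is_C2 R ('rV[R]_d * 'rV[R]_d)%type
                        (fun z => H (tproj z.1) z.2 i))
    (A1 : forall x i, @convex_function R 'rV[R]_d setT (fun p => H x p i))
    (A2_superlinear : unif_lim_pinfty (fun x p i => H x p i / enorm p))
    (A2_gradient : unif_lim_pinfty (fun x p i =>
       (2 * d%:R)^-1 * H x p i ^+ 2 + dot (DxH H x p i) p))
    (A3 : exists2 C : R, 0 < C & forall x p i,
       enorm (DxH H x p i) <= C * (1 + enorm p ^+ 2))
    (A4 : forall i j, c i j = c j i)
    (v1 v2 : torus R d -> 'I_n.+1 -> R)
    (v1_lip : torus_lipschitz v1) (v2_lip : torus_lipschitz v2)
    (v1_sol : viscosity_solution H c v1) (v2_sol : viscosity_solution H c v2)
    (v12 : forall x i, mather_set H c (x, i) -> v1 x i = v2 x i) :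
  forall x i, v1 x i = v2 x i.
Proof.
have [C C_gt0 A3'] := A3.
have [K1 K10 v1K] := torus_lipschitz_lift v1_lip.
have [K2 K20 v2K] := torus_lipschitz_lift v2_lip.
have [[v1_sub v1_sup] [v2_sub v2_sup]] := (v1_sol, v2_sol).
have C0 := ltW C_gt0.
move=> x i; apply/eqP; rewrite eq_le; apply/andP; split.
  exact: (subsolution_le_supersolution H_C2 A1 C0 A3' c_ge0 K10 v1K v1_sub v2_sup v12).
apply: (subsolution_le_supersolution H_C2 A1 C0 A3' c_ge0 K20 v2K v2_sub v1_sup).
by move=> y j yj; rewrite v12.
Qed.
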